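(* Let $u_h^n\in X_h$, $1\le n\le2KN$, be the solution, on the symmetric graded time mesh with $r>1$, of the fully discrete finite element scheme $$(D^\alpha u_h^n,v_h)+B(u_h^n,v_h)=(bJ^{1-\alpha}u_h^{n-2N},v_h)+(G^n,v_h)\quad\forall v_h\in X_h,$$ with $u_h^{n-2N}=\varphi_h^{n-2N}\in X_h$ for $1\le n\le2N$. Then, for $1\le n\le 2KN$, $$\|u_h^n\|\le2E_{\alpha,1}\big(2\max(1,\sigma)\Lambda t_n^\alpha\big)\left(\|u_h^0\|+\omega_{1+\alpha}(t_n)\max_{1\le j\le n}z_j\right),$$ where $z_j=2\big(c|b|\,\omega_{2-\alpha}(t_j)+\|G^j\|\big)$, $c=\sup_{1\le k\le2N}\|u_h^{k-2N}\|$, $\Lambda=(|b|^2+1)\,\omega_{2-\alpha}(K\tau)$ and $\sigma=\max\{3^{r-1},2^r-1\}$.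
   Context: The scheme approximates the delay subdiffusion problem ${}_0^C\mathrm D_t^\alpha u=p\Delta u+au+{}_0I_t^{1-\alpha}[bu(x,t-\tau)]+G$ on $\Omega_T=(0,L)\times(0,K\tau]$, with $u=\varphi$ on $\Omega\times[-\tau,0]$ and zero Dirichlet boundary values, where $0<\alpha<1$, $\tau>0$, $K\in\mathbb N^+$, $p>0$, $a\le0$, $b\ne0$ are constants, $\Omega=(0,L)$, $G={}_0I_t^{1-\alpha}f$ with $f$ and $\varphi$ continuous. Here $\omega_\beta(t)=t^{\beta-1}/\Gamma(\beta)$, ${}_0I_t^{\beta}v(t)=\int_0^t\omega_\beta(t-s)v(s)\,ds$, ${}_0^C\mathrm D_t^\alpha u(x,t)=\int_0^t\omega_{1-\alpha}(t-s)\partial_su(x,s)\,ds$, and $E_{\alpha,1}(z)=\sum_{i=0}^\infty\frac{z^i}{\Gamma(i\alpha+1)}$. Symmetric graded mesh: for an integer $N\ge 2$, $t_{-2N}=-\tau$ and, for $i=0,1,\dots,K$, $$t_n=\begin{cases}\frac{\tau}{2}\left(\frac{n-2(i-1)N}{N}\right)^r+(i-1)\tau,& 2(i-1)N+1\le n<(2i-1)N,\\ -\frac{\tau}{2}\left(\frac{2iN-n}{N}\right)^r+i\tau,&(2i-1)N\le n\le 2iN.\end{cases}$$ Put $\rho_n=t_n-t_{n-1}$, $\nabla_tv^n=v^n-v^{n-1}$, $G^n=G(\cdot,t_n)$, $$a^{(n)}_{n-k}=\frac{\omega_{2-\alpha}(t_n-t_{k-1})-\omega_{2-\alpha}(t_n-t_k)}{\rho_k},\qquad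 D^\alpha v^n=\sum_{k=1}^na^{(n)}_{n-k}\nabla_tv^k,\qquad J^{1-\alpha}v^{n-2N}=\sum_{k=1}^n\rho_k\,a^{(n)}_{n-k}v^{k-2N}.$$ $X_h\subset H_0^1(\Omega)$ is the continuous piecewise linear finite element space on a quasi-uniform mesh of $\Omega$ with maximal diameter $h$; $(u,v)=\int_\Omega uv\,dx$, $\|u\|=(u,u)^{1/2}$, $B(u,v)=p\left(\frac{du}{dx},\frac{dv}{dx}\right)-(au,v)$. $\varphi_h^{n-2N}$ is a suitable approximation in $X_h$ of $\varphi(\cdot,t_{n-2N})$. *)

(* Defs.v *)
From mathcomp Require Import all_boot all_order all_algebra.
From mathcomp Require Import all_classical all_reals all_analysis.
Set Implicit Arguments.
Unset Strict Implicit.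
Unset Printing Implicit Defensive.
Import Order.TTheory GRing.Theory Num.Theory.
Import numFieldNormedType.Exports.
Local Open Scope classical_set_scope.
Local Open Scope ring_scope.

(** * Fractional calculus *)

Definition Gamma (R : realType) (b : R) : R :=
  (\int[lebesgue_measure]_(x in `]0%R, +oo[) (x `^ (b - 1) * expR (- x)))%R.

(* For t = 0 this is 0 whenever b <> 1, because [0 `^ a = 0] for [a != 0];
   in particular [omega (2 - alpha) 0 = 0] when 0 < alpha < 1. *)
Definition omega (R : realType) (b t : R) : R := t `^ (b - 1) / Gamma b.

Definition frac_int (R : realType) (b : R) (v : R -> R) (t : R) : R :=
  (\int[lebesgue_measure]_(s in `]0%R, t[) (omega b (t - s) * v s))%R.

(* E_{alpha,1} *)
Definition mittag_leffler (R : realType) (alpha z : R) : R :=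
  limn (series (fun i : nat => z ^+ i / Gamma (i%:R * alpha + 1))).

(** * Symmetric graded time mesh *)

(* The nodes are indexed by the integers -2N, ..., 2KN; the values of [t]
   outside this range are irrelevant. *)
Definition symmetric_graded_mesh (R : realType) (tau r : R) (N K : nat)
    (t : int -> R) : Prop :=
  t (- (2 * N%:Z)) = - tau /\
  forall (i : nat) (n : int), (i <= K)%N ->
    (2 * (i%:Z - 1) * N%:Z + 1 <= n < (2 * i%:Z - 1) * N%:Z ->
       t n = tau / 2 * ((n - 2 * (i%:Z - 1) * N%:Z)%:~R / N%:R) `^ r
             + (i%:R - 1) * tau) /\
    ((2 * i%:Z - 1) * N%:Z <= n <= 2 * i%:Z * N%:Z ->
       t n = - (tau / 2) * ((2 * i%:Z * N%:Z - n)%:~R / N%:R) `^ r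
             + i%:R * tau).

Definition rho (R : realType) (t : int -> R) (n : nat) : R :=
  t n%:Z - t (n%:Z - 1).

(* [L1coef alpha t n k] is the coefficient a^{(n)}_{n-k}. *)
Definition L1coef (R : realType) (alpha : R) (t : int -> R) (n k : nat) : R :=
  (omega (2 - alpha) (t n%:Z - t (k%:Z - 1))
   - omega (2 - alpha) (t n%:Z - t k%:Z)) / rho t k.

Definition L1deriv (R : realType) (alpha : R) (t : int -> R) (v : int -> R)
    (n : nat) : R :=
  \sum_(1 <= k < n.+1) L1coef alpha t n k * (v k%:Z - v (k%:Z - 1)).

(* J^{1-alpha} v^{n-2N} *)
Definition delay_int (R : realType) (alpha : R) (t : int -> R) (N : nat)
    (v : int -> R) (n : nat) : R :=
  \sum_(1 <= k < n.+1) rho t k * L1coef alpha t n k * v (k%:Z - 2 * N%:Z).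

(** * Finite elements on Omega = (0, L) *)

Definition inner (R : realType) (L : R) (v w : R -> R) : R :=
  (\int[lebesgue_measure]_(x in `]0%R, L[) (v x * w x))%R.

Definition l2norm (R : realType) (L : R) (v : R -> R) : R :=
  Num.sqrt (inner L v v).

(* A space mesh is a list [s] with [itv_partition 0 L s]: its nodes are
   [0 :: s], and its i-th element is the closed interval between the nodes
   i and i + 1. *)
Definition elt_left (R : realType) (L : R) (s : seq R) (i : nat) : R :=
  nth L (0 :: s) i.
Definition elt_right (R : realType) (L : R) (s : seq R) (i : nat) : R :=
  nth L s i.

Definition mesh_size (R : realType) (L : R) (s : seq R) : R :=
  \big[Num.max/0]_(i < size s) (elt_right L s i - elt_left L s i).

Definition quasi_uniform (R : realType) (q L : R) (s : seq R) : Prop :=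
  forall i : nat, (i < size s)%N ->
    mesh_size L s <= q * (elt_right L s i - elt_left L s i).

(* Only the values on [0, L] matter. *)
Definition Xh (R : realType) (L : R) (s : seq R) (v : R -> R) : Prop :=
  [/\ {within `[0, L], continuous v},
      v 0 = 0, v L = 0 &
      forall i : nat, (i < size s)%N ->
        exists c d : R, forall x : R,
          x \in `[elt_left L s i, elt_right L s i] -> v x = c * x + d].

(* The weak derivative of an element of [Xh] is its classical derivative away
   from the finitely many nodes, hence almost everywhere. *)
Definition bform (R : realType) (p a L : R) (v w : R -> R) : R :=
  p * inner L (derive1 v) (derive1 w) - inner L (fun x => a * v x) w.

Definition fem_scheme (R : realType) (alpha p a b L : R) (N K : nat)
    (t : int -> R) (s : seq R) (G : nat -> R -> R) (u : int -> R -> R) : Prop :=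
  forall n : nat, (1 <= n <= 2 * K * N)%N ->
    Xh L s (u n%:Z) /\
    forall v : R -> R, Xh L s v ->
      inner L (fun x => L1deriv alpha t (fun k => u k x) n) v
        + bform p a L (u n%:Z) v
      = inner L (fun x => b * delay_int alpha t N (fun k => u k x) n) v
        + inner L (G n) v.

(* Main.v *)
(* Testing the scheme with u_h^n, the nonnegative and increasing weights of the
   discrete Caputo derivative D turn it into a scalar inequality for
   w_n = |u_h^n|:

     D w^n <= |b| J w^(n-2N) + |G^n| <= Lambda * (max of w_k, k <= n - 2N) + Z.

   By the discrete maximum principle w is bounded by every supersolution W of
   this inequality with W(0) >= w_0.  Take W to be a truncation of
   w_0 * sum_m Lambda^m omega_(1+m alpha) + Z * sum_m Lambda^m omega_(1+(m+1) alpha).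
   It is a supersolution because

     D omega_(1+y) (t_n) >= omega_(1-alpha+y) (t_n - tau)  for y >= alpha:

   if y <= 1, Chebyshev's integral inequality on each step (the kernel increases,
   omega_y decreases) even gives the value at t_n; if y >= 1, the mean of omega_y
   over a step I dominates omega_y (s - tau) for s in I, since steps are at most
   tau.  The loss of tau is harmless because of the delay: t_(n-2N) = t_n - tau.
   This is also why no restriction on the step size is needed. *)
From HB Require Import structures.
Require Import Defs.
From mathcomp Require Import all_boot all_order all_algebra.
From mathcomp Require Import all_classical all_reals all_analysis.
From mathcomp Require Import measurable_realfun.
From mathcomp Require Import ring lra zify.
Import Order.TTheory GRing.Theory Num.Theory.
Import numFieldNormedType.Exports.
Local Open Scope classical_set_scope.
Local Open Scope ring_scope.
Set Implicit Arguments.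
Unset Strict Implicit.
Unset Printing Implicit Defensive.

(** * The Gamma function and the kernels omega *)

(** The analysis rests on the semigroup law omega_x * omega_y = omega_(x+y). In D omega_(1+y) the
    two convolved kernels may be singular at opposite ends of the interval. So the law is proved by
    Tonelli for nonnegative extended-real integrands on the whole line, with kernels cut off at 0;
    integrability and the integrals of single kernels are then read off from it. The supersolution
    is truncated because D acts termwise on finite sums; convergence of the series enters only in
    the final comparison with E. Powers of Lambda arise by feedback: D of the term m + 1 dominates
    Lambda times the delayed term m. Here Lambda bounds the total weight of the delay terms with
    index k > 2N, while those with k <= 2N see only initial data, are bounded through c and join the
    source in Z. *)

Section affine.
Context {R : realType}.
Local Notation mu := (@lebesgue_measure R).

Variables (c k : R) (k0 : 0 < k).
Let phi : measurableTypeR R -> measurableTypeR R := fun x => k * x + c.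

Let mphi : measurable_fun setT phi.
Proof. by apply: measurable_funD => //; exact: measurable_funM. Qed.

Let pmu : {measure set (measurableTypeR R) -> \bar R}.
Proof.
exact: (@measure_function_pushforward__canonical__measure_function_Measure
  _ _ _ _ R mu phi mphi).
Defined.

(** Lebesgue measure and [k] times its pushforward under x -> k x + c agree on half-open intervals,
    hence everywhere. For nonnegative integrands no integrability has to be known. *)
Lemma ge0_integral_affine (f : R -> \bar R) :
  measurable_fun setT f -> (forall x, 0 <= f x)%E ->
  (\int[mu]_x f x = k%:E * \int[mu]_x f (k * x + c)%R)%E.
Proof.
move=> mf f0.
have muE A : measurable A -> mu A = mscale (NngNum (ltW k0)) pmu A.
  move=> mA; apply: lebesgue_measure_unique => //= _ [[a b]] _ <-.
  rewrite /mscale /= /pushforward.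
  have -> : phi @^-1` `]a, b] = `](a - c) / k, (b - c) / k]%classic.
    apply/seteqP; split=> x /=; rewrite !in_itv/= /phi.
      by rewrite ltr_pdivrMr// ler_pdivlMr// ltrBlDr lerBrDr ![x * k]mulrC.
    by rewrite ltr_pdivrMr// ler_pdivlMr// ltrBlDr lerBrDr ![x * k]mulrC.
  rewrite !lebesgue_measure_itv/= !lte_fin ltr_pM2r ?invr_gt0// ltrD2r.
  case: ifP => // _; rewrite ?mule0// -!EFinB -EFinM; congr EFin.
  by field; rewrite gt_eqF.
transitivity (\int[mscale (NngNum (ltW k0)) pmu]_x f x)%E.
  by apply: eq_measure_integral => A mA _; exact: muE.
rewrite ge0_integral_mscale//=; congr (_ * _)%E.
exact: (ge0_integral_pushforward mphi).
Qed.
End affine.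
Section truncated_power.
Context {R : realType}.
Implicit Types x s k : R.

(** The cut-off turns a convolution over []0, u[] into an integral over the whole line, where
    translation and scaling do not move the bounds. *)
Definition tpow x s : R := s `^ (x - 1) * \1_(`]0%R, +oo[%classic) s.

Lemma tpow_gt0E x s : 0 < s -> tpow x s = s `^ (x - 1).
Proof. by move=> s0; rewrite /tpow indicE mem_set ?mulr1//= in_itv/= s0. Qed.

Lemma tpow_le0E x s : s <= 0 -> tpow x s = 0.
Proof.
move=> s0; rewrite /tpow indicE memNset ?mulr0//= in_itv/= andbT.
by apply/negP; rewrite -leNgt.
Qed.

Lemma tpow_ge0 x s : 0 <= tpow x s.
Proof.
have [s0|s0] := ltP 0 s; last by rewrite tpow_le0E.
by rewrite tpow_gt0E// powR_ge0.
Qed.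

Lemma measurable_tpow x : measurable_fun setT (tpow x).
Proof.
by apply: measurable_funM; [exact: measurable_powR|exact: measurable_indic].
Qed.

Lemma tpowM x k s : 0 < k -> tpow x (k * s) = k `^ (x - 1) * tpow x s.
Proof.
move=> k0; have [s0|s0] := ltP 0 s.
  by rewrite !tpow_gt0E// ?mulr_gt0// powRM// ltW.
by rewrite !tpow_le0E ?mulr0 ?pmulr_rle0.
Qed.

End truncated_power.

Section power_integral.
Context {R : realType}.
Local Notation mu := (@lebesgue_measure R).
Implicit Types x y s e : R.

(** Away from 0 the integrand is continuous even for x < 1. The bound is independent of [e], which
    can then tend to 0. *)
Lemma integral_powR_itvcc x e : (0 < x)%R -> (0 < e < 1)%R ->
  (\int[mu]_(s in `[e, 1%R]) (s `^ (x - 1)%R)%:E <= (x^-1)%:E)%E.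
Proof.
move=> x0 /andP[e0 e1].
have der z : (e <= z)%R -> is_derive z 1%R (fun s => s `^ x / x)%R (z `^ (x - 1)).
  move=> ez; have z0 : (0 < z)%R by exact: lt_le_trans ez.
  have := is_derive1_powR x z0 => dz.
  apply: is_derive_eq; rewrite /= ?scaler0 ?add0r.
  by rewrite /GRing.scale/=; field; rewrite gt_eqF.
have dpow y z : (e <= z)%R -> derivable (@powR R ^~ y) z 1.
  move=> ez; apply: derivable_powR; rewrite in_itv/= andbT.
  exact: lt_le_trans ez.
have cF z : (e <= z)%R -> {for z, continuous (fun s => s `^ x / x)%R}.
  move=> ez; apply: differentiable_continuous; apply/derivable1_diffP.
  by have [] := der z ez.
rewrite (@continuous_FTC2 _ _ (fun s => s `^ x / x)%R)//.
- rewrite -EFinB lee_fin powR1 lerBlDr div1r lerDl divr_ge0 ?powR_ge0//.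
  exact: ltW.
- apply: derivable_within_continuous => z; rewrite in_itv/= => /andP[ez _].
  exact: dpow.
- split.
  + move=> z; rewrite in_itv/= => /andP[/ltW ez _].
    by have [] := der z ez.
  + by apply: cvg_at_right_filter; exact: cF.
  + by apply: cvg_at_left_filter; apply: cF; exact: ltW.
- move=> z; rewrite in_itv/= => /andP[/ltW ez _].
  rewrite derive1E. by have [] := der z ez.
Qed.

Lemma integral_powR_itvoc x : (0 < x)%R ->
  (\int[mu]_(s in `]0%R, 1%R]) (s `^ (x - 1)%R)%:E <= (x^-1)%:E)%E.
Proof.
move=> x0.
(* The shift [n.+2] keeps the left end strictly below 1, as the bound on [[e, 1]] demands. *)
pose F (n : nat) : set R := `[n.+2%:R^-1, 1%R]%classic.
have -> : `]0%R, 1%R]%classic = \bigcup_n F n.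
  apply/seteqP; split=> s /=.
    rewrite in_itv/= => /andP[s0 s1].
    have [n ns] : exists n : nat, (n.+2%:R^-1 <= s)%R.
      exists (Num.truncn s^-1).
      rewrite invf_ple ?posrE//.
      apply: (le_trans (ltW (truncnS_gt _))).
      by rewrite ler_nat.
    by exists n => //=; rewrite /F /= in_itv/= ns.
  move=> [n _]; rewrite /F/= !in_itv/= => /andP[ns ->]; rewrite andbT.
  by rewrite (lt_le_trans _ ns).
have mp A : measurable_fun A (fun s : R => (s `^ (x - 1))%:E).
  apply/measurable_EFinP; apply: measurable_funTS; exact: measurable_powR.
have Fnd : nondecreasing_seq F.
  move=> m n mn; apply/subsetPset => s; rewrite /F/= !in_itv/= => /andP[ns ->].
  rewrite andbT (le_trans _ ns)// lef_pV2 ?posrE// ler_nat. by rewrite !ltnS.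
have cF : (\int[mu]_(s in F i) (s `^ (x - 1)%R)%:E @[i --> \oo] -->
    \int[mu]_(s in \bigcup_i F i) (s `^ (x - 1)%R)%:E)%E.
  apply: ge0_nondecreasing_set_cvg_integral => [//|n|n|n s _].
  - exact: measurable_itv.
  - exact: mp.
  - by rewrite lee_fin powR_ge0.
rewrite -(cvg_lim _ cF)//; apply: lime_le; first by apply/cvg_ex; eexists; exact: cF.
near=> n; apply: integral_powR_itvcc => //.
by rewrite invr_gt0 ltr0n/= invf_lt1 ?ltr1n.
Unshelve. all: by end_near. Qed.

(** For an integer n >= x - 1, s^(x-1) <= s^n = (2n)^n (s/(2n))^n, and s/(2n) <= exp(s/(2n)).
    Against exp(-s) this leaves the integrable factor exp(-s/2). *)
Lemma powR_expR_le x : exists2 C : R, (0 <= C)%R &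
  forall s, (1 <= s)%R -> (s `^ (x - 1) <= C * expR (s / 2))%R.
Proof.
pose n := (Num.truncn x).+1.
exists ((2 * n%:R) ^+ n)%R; first by rewrite exprn_ge0.
move=> s s1; have s0 : (0 <= s)%R by exact: le_trans s1.
apply: (@le_trans _ _ (s ^+ n)%R).
  rewrite -powR_mulrn// ler_powR// (le_trans _ (ltW (truncnS_gt x)))//.
  by rewrite gerBl.
have n0 : (0 < n%:R :> R)%R by rewrite ltr0n.
rewrite -ler_pdivrMl ?exprn_gt0 ?mulr_gt0// -exprVn -exprMn.
have -> : expR (s / 2) = (expR ((2 * n%:R)^-1 * s) ^+ n)%R.
  by rewrite -expRM_natl; congr expR; field; rewrite gt_eqF.
rewrite lerXn2r ?nnegrE ?expR_ge0// ?mulr_ge0// ?invr_ge0 ?mulr_ge0//.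
by apply: le_trans (expR_ge1Dx _); rewrite lerDr.
Qed.


End power_integral.

(** * Gamma function, beta integral and semigroup law *)

Section gamma.
Context {R : realType}.
Local Notation mu := (@lebesgue_measure R).
Implicit Types x y s u : R.
Local Open Scope ereal_scope.

(** Extended-real Gamma function, so that Tonelli applies before finiteness is known. *)
Let eGamma x : \bar R := \int[mu]_s (tpow x s * expR (- s))%:E.

Let mker x : measurable_fun setT (fun s => tpow x s * expR (- s))%R.
Proof.
apply: measurable_funM; first exact: measurable_tpow.
by apply: measurableT_comp => //; exact: oppr_measurable.
Qed.

Let ker_ge0 x s : (0 <= tpow x s * expR (- s))%R.
Proof. by rewrite mulr_ge0 ?tpow_ge0 ?expR_ge0. Qed.

Let eGamma_ge0 x : 0 <= eGamma x.
Proof. by apply: integral_ge0 => s _; rewrite lee_fin ker_ge0. Qed.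

Let GammaE x : Gamma x = fine (eGamma x).
Proof.
rewrite /Gamma /Rintegral /eGamma integral_mkcond; congr fine.
apply: eq_integral => s _; rewrite patchE; case: ifPn => sP.
  by rewrite tpow_gt0E//; move: sP; rewrite inE/= in_itv/= andbT.
rewrite tpow_le0E ?mul0r//; rewrite leNgt; apply: contra sP.
by rewrite inE/= in_itv/= andbT.
Qed.

(** Euler's beta integral B(x, y). *)
Definition ebeta x y : \bar R := \int[mu]_s (tpow x (1 - s) * tpow y s)%:E.

Let mconv x y u : measurable_fun setT (fun s => tpow x (u - s) * tpow y s)%R.
Proof.
apply: measurable_funM; last exact: measurable_tpow.
apply: measurableT_comp; first exact: measurable_tpow.
exact: measurable_funB.
Qed.

(** Homogeneity: the substitution s -> u s pulls out u^(x-1), u^(y-1) and the Jacobian u. *)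
Lemma tpow_conv x y u : (0 < u)%R ->
  \int[mu]_s (tpow x (u - s) * tpow y s)%:E = (u `^ (x + y - 1))%:E * ebeta x y.
Proof.
move=> u0; rewrite (ge0_integral_affine 0 u0); last 2 first.
  by apply/measurable_EFinP; exact: mconv.
  by move=> s; rewrite lee_fin mulr_ge0 ?tpow_ge0.
under eq_integral => s _.
  rewrite addr0 -[X in (X - u * s)%R](mulr1 u) -mulrBr !tpowM// mulrACA EFinM.
  over.
rewrite ge0_integralZl//; last 3 first.
  by apply/measurable_EFinP; exact: mconv.
  by move=> s _; rewrite lee_fin mulr_ge0 ?tpow_ge0.
  by rewrite lee_fin mulr_ge0 ?powR_ge0.
rewrite muleA; congr (_ * _); rewrite -EFinM; congr EFin.
have uN0 : u != 0%R by rewrite gt_eqF.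
rewrite -{1}(powRr1 (ltW u0)) -!powRD ?uN0 ?implybT//.
congr (_ `^ _)%R; ring.
Qed.

(* Tonelli's theorem after the substitution [u = s + s']. *)
Let eGammaM x y : eGamma x * eGamma y = eGamma (x + y) * ebeta x y.
Proof.
transitivity (\int[mu]_s \int[mu]_u
    (tpow x (u - s) * tpow y s * expR (- u))%:E).
  rewrite muleC {1}/eGamma -ge0_integralZr//; last 2 first.
  - by apply/measurable_EFinP; exact: mker.
  - by move=> s _; rewrite lee_fin ker_ge0.
  apply: eq_integral => s _.
  rewrite /eGamma -ge0_integralZl//; last 3 first.
  - by apply/measurable_EFinP; exact: mker.
  - by move=> ? _; rewrite lee_fin ker_ge0.
  - by rewrite lee_fin ker_ge0.
  rewrite [LHS](ge0_integral_affine (- s)%R ltr01)//; last 2 first.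
  - under eq_fun do rewrite -EFinM.
    apply/measurable_EFinP; exact: measurable_funM.
  - by move=> r; rewrite mule_ge0// lee_fin ker_ge0.
  rewrite mul1e; apply: eq_integral => u _.
  rewrite -EFinM; congr EFin; rewrite mul1r mulrACA -expRD.
  rewrite [(tpow y s * _)%R]mulrC; congr (_ * expR _)%R; ring.
pose F (p : measurableTypeR R * measurableTypeR R) : \bar R :=
  (tpow x (p.2 - p.1) * tpow y p.1 * expR (- p.2))%:E.
have mF : measurable_fun setT F.
  apply/measurable_EFinP; apply: measurable_funM; first apply: measurable_funM.
  - apply: (measurableT_comp (measurable_tpow x)).
    by apply: measurable_funB; [exact: measurable_snd|exact: measurable_fst].
  - exact: (measurableT_comp (measurable_tpow y) measurable_fst).
  - apply: (measurableT_comp (@measurable_expR R)).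
    exact: (measurableT_comp (@oppr_measurable R setT) measurable_snd).
have F0 p : 0 <= F p.
  rewrite lee_fin; apply: mulr_ge0; last exact: expR_ge0.
  by apply: mulr_ge0; exact: tpow_ge0.
rewrite (fubini_tonelli F mF F0) /F/= {mF F0 F}.
rewrite -ge0_integralZr//; last 3 first.
- by apply/measurable_EFinP; exact: mker.
- by move=> s _; rewrite lee_fin ker_ge0.
- by apply: integral_ge0 => s _; rewrite lee_fin mulr_ge0 ?tpow_ge0.
apply: eq_integral => u _.
under eq_integral do rewrite EFinM.
rewrite ge0_integralZr//; last 2 first.
- by apply/measurable_EFinP; exact: mconv.
- by move=> s _; rewrite lee_fin mulr_ge0 ?tpow_ge0.
have [u0|u0] := ltP 0%R u.
  by rewrite tpow_conv// tpow_gt0E// EFinM muleAC.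
rewrite [tpow (x + y) u]tpow_le0E// mul0r mul0e integral0_eq ?mul0e// => s _.
have [s0|s0] := ltP 0%R s; last by rewrite [tpow y s]tpow_le0E// mulr0.
by rewrite tpow_le0E ?mul0r// subr_le0 (le_trans u0)// ltW.
Qed.

(** The integrand is at most s^(x-1) on []0, 1]] and C exp(-s/2) beyond; the latter is 2C times the
    exponential density of rate 1/2, whose mass is 1. *)
Let eGamma_lty x : (0 < x)%R -> eGamma x < +oo.
Proof.
move=> x0; have [C C0 Cle] := powR_expR_le x.
have ih0 : (0 < 2^-1 :> R)%R by rewrite invr_gt0.
have mp : measurable_fun setT
    (fun s : R => (s `^ (x - 1) * \1_(`]0%R, 1%R]%classic) s)%:E).
  apply/measurable_EFinP; apply: measurable_funM.
    exact: measurable_powR.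
  exact: measurable_indic.
have me : measurable_fun setT (fun s : R => (exponential_pdf 2^-1 s)%:E).
  by apply/measurable_EFinP; exact: measurable_exponential_pdf.
have e0 s : (0 <= exponential_pdf 2^-1 s :> R)%R.
  exact/exponential_pdf_ge0/ltW.
have p0 s : (0 <= s `^ (x - 1) * \1_(`]0%R, 1%R]%classic) s :> R)%R.
  by rewrite mulr_ge0 ?powR_ge0.
apply: (@le_lt_trans _ _ (\int[mu]_s ((s `^ (x - 1) * \1_(`]0%R, 1%R]%classic) s)%:E
   + (2 * C)%:E * (exponential_pdf 2^-1 s)%:E))).
  apply: ge0_le_integral => //.
  - by move=> s _; rewrite lee_fin ker_ge0.
  - by apply/measurable_EFinP; exact: mker.
  - apply: emeasurable_funD => //.
    by apply/measurable_EFinP; apply: measurable_funM => //; exact/measurable_EFinP.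
  - move=> s _; rewrite -EFinM -EFinD lee_fin.
    have [s0|s0] := leP s 0%R.
      by rewrite tpow_le0E// mul0r addr_ge0// mulr_ge0// mulr_ge0.
    rewrite tpow_gt0E//.
    have [s1|s1] := leP s 1%R.
      rewrite indicE mem_set /= ?in_itv/= ?s0 ?s1// mulr1.
      rewrite -[leLHS]addr0 lerD//; last first.
        by rewrite mulr_ge0// mulr_ge0.
      by rewrite ler_piMr ?powR_ge0// expR_le1 oppr_le0 ltW.
    rewrite -[leLHS]add0r lerD// exponential_pdfE ?(ltW s0)//.
    have -> : (2 * C * (2^-1 * expR (- 2^-1 * s)) = C * expR (s / 2) * expR (- s))%R.
      rewrite -[RHS]mulrA -expRD.
      have -> : (s / 2 + - s = - 2^-1 * s)%R by field.
      by field.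
    by rewrite ler_wpM2r ?expR_ge0// Cle// ltW.
rewrite ge0_integralD//; last 3 first.
- by move=> s _; rewrite lee_fin.
- by move=> s _; rewrite -EFinM lee_fin mulr_ge0// mulr_ge0.
- by apply/measurable_EFinP; apply: measurable_funM => //; exact/measurable_EFinP.
rewrite ge0_integralZl//; last 2 first.
- by move=> s _; rewrite lee_fin.
- by rewrite lee_fin mulr_ge0.
rewrite integral_exponential_pdf// mule1.
apply: lte_add_pinfty; last exact: ltry.
apply: (@le_lt_trans _ _ (x^-1)%:E); last exact: ltry.
apply: le_trans (integral_powR_itvoc x0).
rewrite [leRHS]integral_mkcond/=.
apply: ge0_le_integral => //.
- by move=> s _; rewrite lee_fin.
- apply/(measurable_restrictT _ _).1 => //; apply/measurable_EFinP.
  by apply: measurable_funTS; exact: measurable_powR.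
- move=> s _; rewrite patchE indicE; case: ifP => //= _; by rewrite ?mulr1 ?mulr0.
Qed.

Let integral_ge_itv (c y : R) (f : R -> R) : (0 <= y)%R ->
  measurable_fun setT f -> (forall s, 0 <= f s)%R ->
  (forall s, (c < s < c + 1)%R -> (y <= f s)%R) ->
  y%:E <= \int[mu]_s (f s)%:E.
Proof.
move=> y0 mf f0 yf.
have <- : \int[mu]_(s in `]c, (c + 1)%R[) (cst y%:E) s = y%:E.
  rewrite integral_cst//= lebesgue_measure_itv/= lte_fin ltrDl ltr01.
  by rewrite -EFinB [(c + 1)%R]addrC addrK mule1.
rewrite integral_mkcond/=; apply: ge0_le_integral => //.
- by move=> s _; rewrite patchE; case: ifP.
- exact/(measurable_restrictT _ _).1.
- exact/measurable_EFinP.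
- move=> s _; rewrite patchE; case: ifPn => [|_]; last by rewrite lee_fin.
  by rewrite inE/= in_itv/= lee_fin => /yf.
Qed.

(** On one unit interval, []1, 2[] if x >= 1 and []0, 1[] otherwise, the power is at least 1 and the
    exponential is bounded below. *)
Let eGamma_gt0 x : (0 < x)%R -> 0 < eGamma x.
Proof.
move=> x0.
have key (c y : R) : (0 <= c)%R -> (0 < y)%R ->
    (forall s, (c < s < c + 1)%R -> (y <= s `^ (x - 1)))%R -> 0 < eGamma x.
  move=> c0 y0 ys.
  have lep : (y * expR (- (c + 1)))%:E <= eGamma x.
    apply: integral_ge_itv => //.
    - by rewrite mulr_ge0 ?expR_ge0// ltW.
    - move=> s /[dup] /ys yl /andP[cs sc].
      rewrite tpow_gt0E ?(le_lt_trans c0)// ler_pM ?expR_ge0 ?(ltW y0)//.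
      by rewrite ler_expR lerN2 ltW.
  by rewrite (lt_le_trans _ lep)// lte_fin mulr_gt0 ?expR_gt0.
have [x1|x1] := leP 1%R x.
- apply: (key 1 1)%R => // s /andP[s1 _].
  rewrite -[leLHS](powRr0 s) ler_powR ?subr_ge0 ?(ltW s1)//.
- apply: (key 0 1)%R => // s; rewrite add0r => /andP[s0 s1].
  by rewrite -[leLHS](powRr0 s) ger_powR ?s0 ?(ltW s1)// subr_le0 ltW.
Qed.

Lemma Gamma_gt0 x : (0 < x)%R -> (0 < Gamma x)%R.
Proof.
by move=> x0; rewrite GammaE fine_gt0// eGamma_gt0//= eGamma_lty.
Qed.

Let eGammaE x : (0 < x)%R -> eGamma x = (Gamma x)%:E.
Proof.
by move=> x0; rewrite GammaE fineK// ge0_fin_numE ?eGamma_ge0// eGamma_lty.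
Qed.

Lemma Gamma1 : Gamma 1 = 1%R :> R.
Proof.
rewrite /Gamma /Rintegral -[RHS]/(fine 1%E); congr fine.
rewrite -(@integral_exponential_pdf R 1)// integral_itv_obnd_cbnd; last first.
  apply/measurable_EFinP; apply: measurable_funTS.
  by under eq_fun do rewrite subrr powRr0 mul1r; exact: measurableT_comp.
rewrite integral_mkcond; apply: eq_integral => s _.
rewrite /exponential_pdf !patchE; case: ifP => // _.
by rewrite subrr powRr0 !mul1r mulN1r.
Qed.

(** Only []A, A + 1[] is kept of the integral. Since [A] is free, Gamma outgrows every geometric
    sequence. *)
Lemma Gamma1D_ge (A y : R) : (0 < A)%R -> (0 <= y)%R ->
  (A `^ y * expR (- (A + 1)) <= Gamma (1 + y))%R.
Proof.
move=> A0 y0; rewrite -lee_fin -eGammaE; last by rewrite ltr_pwDl.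
apply: (@integral_ge_itv A) => //.
- by rewrite mulr_ge0 ?expR_ge0 ?powR_ge0.
- move=> s /andP[As sA]; have s0 := lt_trans A0 As.
  rewrite tpow_gt0E// addrAC subrr add0r.
  rewrite ler_pM ?expR_ge0 ?powR_ge0 ?ler_expR ?lerN2 ?(ltW sA)//.
  by apply: ge0_ler_powR => //; rewrite ?nnegrE; apply: ltW.
Qed.

(** The product formula also yields finiteness: an infinite beta integral would make the finite
    product Gamma(x) Gamma(y) infinite. *)
Lemma ebetaE x y : (0 < x)%R -> (0 < y)%R ->
  ebeta x y = (Gamma x * Gamma y / Gamma (x + y))%:E.
Proof.
move=> x0 y0; have xy0 : (0 < x + y)%R by rewrite addr_gt0.
have := eGammaM x y; rewrite !eGammaE//.
have : 0 <= ebeta x y.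
  by apply: integral_ge0 => s _; rewrite lee_fin mulr_ge0 ?tpow_ge0.
case: (ebeta x y) => [b _||//].
- rewrite -!EFinM => -[] ->; congr EFin; rewrite mulrAC divff ?mul1r//.
  exact: lt0r_neq0 (Gamma_gt0 xy0).
- by move=> _; rewrite gt0_muley// lte_fin; exact: Gamma_gt0 xy0.
Qed.

(* [omega x] truncated to [s > 0], where it is the convolution kernel; the real
   power in [omega] does not vanish for [s < 0]. *)
Definition komega x s : R := (tpow x s / Gamma x)%R.

Lemma komegaE x s : (0 < s)%R -> komega x s = omega x s.
Proof. by move=> s0; rewrite /komega tpow_gt0E. Qed.

(** Semigroup law of the Riemann-Liouville kernels: their normalisation cancels the Gamma factors of
    the beta integral. *)
Lemma komega_conv x y u : (0 < x)%R -> (0 < y)%R -> (0 < u)%R ->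
  \int[mu]_s (komega x (u - s) * komega y s)%:E = (omega (x + y) u)%:E.
Proof.
move=> x0 y0 u0.
have gx := Gamma_gt0 x0; have gy := Gamma_gt0 y0.
have gxy := Gamma_gt0 (addr_gt0 x0 y0).
have gxgy0 : (0 <= (Gamma x * Gamma y)^-1)%R.
  by rewrite invr_ge0; exact: mulr_ge0 (ltW gx) (ltW gy).
under eq_integral => s _.
  have -> : (komega x (u - s) * komega y s = (Gamma x * Gamma y)^-1 *
      (tpow x (u - s) * tpow y s))%R.
    by rewrite /komega mulrACA -invfM mulrC.
  rewrite EFinM; over.
rewrite ge0_integralZl//; last 2 first.
- by apply/measurable_EFinP; exact: mconv.
- by move=> s _; rewrite lee_fin mulr_ge0 ?tpow_ge0.
rewrite tpow_conv// ebetaE// -!EFinM /omega; congr EFin.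
move: (Gamma x) (Gamma y) (Gamma _) (_ `^ _)%R gx gy gxy => A B C X.
by move=> /lt0r_neq0 A0 /lt0r_neq0 B0 /lt0r_neq0 C0; field; rewrite A0 B0 C0.
Qed.

End gamma.

(** * Integrals of kernels and of their products over intervals *)

Section kernel_integrals.
Context {R : realType}.
Local Notation mu := (@lebesgue_measure R).
Implicit Types x y s u a b d : R.

Lemma komega_le0E x s : s <= 0 -> komega x s = 0.
Proof. by move=> s0; rewrite /komega tpow_le0E// mul0r. Qed.

Lemma komega_ge0 x s : 0 < x -> 0 <= komega x s.
Proof. by move=> x0; rewrite divr_ge0 ?tpow_ge0 ?(ltW (Gamma_gt0 x0)). Qed.

Lemma measurable_komega x : measurable_fun setT (komega x).
Proof. by apply: measurable_funM => //; exact: measurable_tpow. Qed.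

Lemma komega1 s : 0 < s -> komega 1 s = 1.
Proof. by move=> s0; rewrite komegaE// /omega subrr powRr0 Gamma1 divr1. Qed.

Lemma omega_ge0 x s : 0 < x -> 0 <= omega x s.
Proof. by move=> x0; rewrite divr_ge0 ?powR_ge0 ?(ltW (Gamma_gt0 x0)). Qed.

Lemma omega_gt0 x s : 0 < x -> 0 < s -> 0 < omega x s.
Proof. by move=> x0 s0; rewrite divr_gt0 ?powR_gt0 ?Gamma_gt0. Qed.

Lemma omega0 x : x != 1 -> omega x 0 = 0 :> R.
Proof. by move=> x1; rewrite /omega powR0 ?mul0r// subr_eq0. Qed.

Lemma omega1 s : omega 1 s = 1.
Proof. by rewrite /omega subrr powRr0 Gamma1 divr1. Qed.

Lemma ler_omega x : 1 <= x -> {in Num.nneg &, {homo omega x : s u / s <= u}}.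
Proof.
move=> x1 s u s0 u0 su; rewrite ler_pM2r ?invr_gt0 ?Gamma_gt0 ?(lt_le_trans ltr01)//.
by apply: ge0_ler_powR; rewrite ?subr_ge0.
Qed.

Lemma ler_komega x : 1 <= x -> {homo komega x : s u / s <= u}.
Proof.
move=> x1 s u su; have x0 : 0 < x by exact: lt_le_trans x1.
have [s0|s0] := leP s 0; first by rewrite komega_le0E// komega_ge0.
have u0 := lt_le_trans s0 su.
by rewrite !komegaE// ler_omega ?nnegrE// ltW.
Qed.

Lemma ler_komega_lt1 x s u : 0 < x <= 1 -> 0 < s -> s <= u ->
  komega x u <= komega x s.
Proof.
move=> /andP[x0 x1] s0 su; have u0 := lt_le_trans s0 su.
rewrite !komegaE// /omega ler_pM2r ?invr_gt0 ?Gamma_gt0//.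
have -> : x - 1 = - (1 - x) by rewrite opprB.
rewrite !powRN lef_pV2 ?posrE ?powR_gt0//.
by apply: ge0_ler_powR; rewrite ?nnegrE ?subr_ge0 ?(ltW s0) ?(ltW u0).
Qed.

Let mconv x y u : measurable_fun setT (fun s => komega x (u - s) * komega y s).
Proof.
apply: measurable_funM; last exact: measurable_komega.
apply: measurableT_comp; first exact: measurable_komega.
exact: measurable_funB.
Qed.

Let conv_ge0 x y u s : 0 < x -> 0 < y -> 0 <= komega x (u - s) * komega y s.
Proof. by move=> x0 y0; rewrite mulr_ge0 ?komega_ge0. Qed.

(** For u > 0 the semigroup law gives the integral a real value; for u <= 0 the supports of the two
    factors are disjoint. *)
Lemma integrable_komega_conv x y u : 0 < x -> 0 < y ->
  mu.-integrable setT (EFin \o (fun s => komega x (u - s) * komega y s)).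
Proof.
move=> x0 y0; apply/integrableP; split; first by apply/measurable_EFinP; exact: mconv.
have [u0|u0] := ltP 0 u.
  under eq_integral do rewrite /= ger0_norm ?conv_ge0//.
  by rewrite komega_conv// ltry.
rewrite integral0_eq ?ltry// => s _ /=.
have [s0|s0] := leP s 0; first by rewrite [komega y s]komega_le0E// mulr0 normr0.
by rewrite komega_le0E ?mul0r ?normr0// subr_le0 (le_trans u0)// ltW.
Qed.

Lemma Rintegral_komega_conv x y u : 0 < x -> 0 < y -> 0 < u ->
  \int[mu]_(s in `]0, u[) (komega x (u - s) * komega y s) = omega (x + y) u.
Proof.
move=> x0 y0 u0; rewrite Rintegral_mkcond /Rintegral -[RHS]/(fine (omega (x + y) u)%:E).
rewrite -komega_conv//; congr fine; apply: eq_integral => s _.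
rewrite patchE; case: ifPn => //; rewrite notin_setE /= in_itv/= => /negP.
rewrite negb_and -!leNgt => /orP[s0|us].
  by rewrite [komega y s]komega_le0E// mulr0.
by rewrite komega_le0E ?mul0r// subr_le0.
Qed.

(** On []a, b[] the factor [komega 1 (b - s)] equals 1, so the single kernel is an instance of a
    convolution integrand. *)
Lemma integrable_komega y a b : 0 < y ->
  mu.-integrable `]a, b[ (EFin \o komega y).
Proof.
move=> y0; apply: (@eq_integrable _ _ _ mu `]a, b[ _
    (EFin \o (fun s => komega 1 (b - s) * komega y s))); last first.
- exact: integrableS (integrable_komega_conv _ ltr01 y0).
- move=> s; rewrite inE/= in_itv/= => /andP[_ sb].
  by rewrite /= komega1 ?mul1r// subr_gt0.
- exact: measurable_itv.
Qed.

Lemma integrable_komega_rev x u a b : 0 < x -> 0 <= a ->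
  mu.-integrable `]a, b[ (EFin \o (fun s => komega x (u - s))).
Proof.
move=> x0 a0; apply: (@eq_integrable _ _ _ mu `]a, b[ _
    (EFin \o (fun s => komega x (u - s) * komega 1 s))); last first.
- exact: integrableS (integrable_komega_conv _ x0 ltr01).
- move=> s; rewrite inE/= in_itv/= => /andP[sa _].
  by rewrite /= [komega 1 s]komega1 ?mulr1// (le_lt_trans a0).
- exact: measurable_itv.
Qed.

Lemma integrable_cst_itv a b (c : R) : mu.-integrable `]a, b[ (EFin \o cst c).
Proof.
apply: (@integrableS _ _ _ mu `[a, b]).
- exact: measurable_itv.
- exact: measurable_itv.
- exact: subset_itv_oo_cc.
- apply: continuous_compact_integrable; first exact: segment_compact.
  exact: cst_continuous.
Qed.

Lemma Rintegral_cst_itv a b (c : R) : a <= b ->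
  \int[mu]_(s in `]a, b[) (cst c s) = c * (b - a).
Proof.
rewrite le_eqVlt => /predU1P[->|ab].
  by rewrite set_itvoo0 Rintegral_set0 subrr mulr0.
by rewrite Rintegral_cst//= lebesgue_measure_itv/= lte_fin ab.
Qed.

Lemma Rintegral_itvoo_split (f : R -> R) a b d : a <= b -> b <= d ->
  mu.-integrable `]a, d[ (EFin \o f) ->
  \int[mu]_(s in `]a, d[) f s =
    \int[mu]_(s in `]a, b[) f s + \int[mu]_(s in `]b, d[) f s.
Proof.
rewrite le_eqVlt => /predU1P[<- _ _|ab].
  by rewrite [X in X + _](_ : _ = 0) ?add0r// set_itvoo0 Rintegral_set0.
rewrite le_eqVlt => /predU1P[<- _|bd intf].
  by rewrite [X in _ + X](_ : _ = 0) ?addr0// set_itvoo0 Rintegral_set0.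
rewrite [X in _ = X + _]Rintegral_itv_bndo_bndc; last first.
  apply: integrableS intf; [exact: measurable_itv|exact: measurable_itv|].
  by apply: subset_itvl; rewrite bnd_simp ltW.
by rewrite -(@Rintegral_itvB _ f _ _ b intf) ?bnd_simp ?(ltW ab)// addrC subrK.
Qed.

(** Over []0, c[] this is convolution with omega_1 = 1; no antiderivative has to be followed into
    the singularity at 0. *)
Lemma Rintegral_komega a b y : 0 < y -> 0 <= a -> a <= b ->
  \int[mu]_(s in `]a, b[) komega y s = omega (1 + y) b - omega (1 + y) a.
Proof.
move=> y0 a0 ab.
have E c : 0 <= c -> \int[mu]_(s in `]0, c[) komega y s = omega (1 + y) c.
  rewrite le_eqVlt => /predU1P[<-|c0].
    by rewrite set_itvoo0 Rintegral_set0 omega0// -subr_eq0 addrAC subrr add0r gt_eqF.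
  rewrite -Rintegral_komega_conv//; apply: eq_Rintegral => s.
  by rewrite inE/= in_itv/= => /andP[s0 sc]; rewrite komega1 ?mul1r// subr_gt0.
rewrite -(E a a0) -(E b (le_trans a0 ab)) (Rintegral_itvoo_split a0 ab).
  by rewrite addrAC subrr add0r.
exact: integrable_komega.
Qed.

Lemma Rintegral_shift (f : R -> R) d a b : measurable_fun setT f ->
  (forall s, 0 <= f s) ->
  \int[mu]_(s in `]a, b[) f (s - d) = \int[mu]_(s in `]a - d, b - d[) f s.
Proof.
move=> mf f0; rewrite /Rintegral; congr fine.
rewrite [RHS]integral_mkcond/= [LHS]integral_mkcond/= [RHS](ge0_integral_affine (- d) ltr01).
- rewrite mul1e; apply: eq_integral => s _; rewrite !patchE !mem_setE !in_itv/= mul1r.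
  by rewrite !ltrD2r.
- by apply/(measurable_restrictT _ _).1 => //; apply/measurable_EFinP; exact: measurable_funTS.
- by move=> s; rewrite patchE; case: ifP; rewrite // lee_fin.
Qed.

Lemma integrable_komega_conv_shift x y u d : 0 < x -> 0 < y ->
  mu.-integrable setT (EFin \o (fun s => komega x (u - s) * komega y (s - d))).
Proof.
move=> x0 y0; have E s : u - s = u - d - (1 * s - d) by ring.
have Es s : s - d = 1 * s - d by rewrite mul1r.
apply/integrableP; split.
  apply/measurable_EFinP; apply: measurable_funM.
    by apply: measurableT_comp; [exact: measurable_komega|exact: measurable_funB].
  by apply: measurableT_comp; [exact: measurable_komega|exact: measurable_funB].
have /integrableP[_] := integrable_komega_conv (u - d) x0 y0.
rewrite (ge0_integral_affine (- d) ltr01)//; last first.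
  by apply/measurableT_comp => //; apply/measurable_EFinP; exact: mconv.
rewrite mul1e; congr (_ < _)%E; apply: eq_integral => s _ /=.
by rewrite -(E s) -(Es s).
Qed.

Lemma Rintegral_komega_conv_shift x y u d : 0 < x -> 0 < y -> 0 <= d -> d < u ->
  \int[mu]_(s in `]0, u[) (komega x (u - s) * komega y (s - d)) = omega (x + y) (u - d).
Proof.
move=> x0 y0 d0 du; rewrite (@Rintegral_itvoo_split _ 0 d u d0 (ltW du)); last first.
  exact: integrableS (integrable_komega_conv_shift u d x0 y0).
rewrite [X in X + _](_ : _ = 0) ?add0r; last first.
  transitivity (\int[mu]_(s in `]0, d[) (cst 0 s)); last first.
    by rewrite Rintegral_cst_itv ?mul0r.
  apply: eq_Rintegral => s; rewrite inE/= in_itv/= => /andP[_ sd].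
  by rewrite [komega y _]komega_le0E ?mulr0// subr_le0 ltW.
rewrite -Rintegral_komega_conv ?subr_gt0//.
have := @Rintegral_shift (fun s => komega x (u - d - s) * komega y s) d d u
  (@mconv _ _ _) (fun s => conv_ge0 _ _ x0 y0).
rewrite subrr => <-; apply: eq_Rintegral => s _.
by congr (komega x _ * _); ring.
Qed.

Lemma Rintegral_komega_rev a b u x : 0 < x -> 0 <= a -> a <= b -> b <= u ->
  \int[mu]_(s in `]a, b[) komega x (u - s) = omega (1 + x) (u - a) - omega (1 + x) (u - b).
Proof.
move=> x0 a0 ab bu.
have E c : 0 <= c -> c <= u ->
    \int[mu]_(s in `]c, u[) komega x (u - s) = omega (1 + x) (u - c).
  move=> c0; rewrite le_eqVlt => /predU1P[<-|cu].
    rewrite subrr set_itvoo0 Rintegral_set0 omega0//.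
    by rewrite -subr_eq0 addrAC subrr add0r gt_eqF.
  rewrite [1 + x]addrC -Rintegral_komega_conv ?subr_gt0//.
  have := @Rintegral_shift (fun s => komega x (u - c - s) * komega 1 s) c c u
    (@mconv _ _ _) (fun s => conv_ge0 _ _ x0 ltr01).
  rewrite subrr => <-.
  apply: eq_Rintegral => s; rewrite inE/= in_itv/= => /andP[cs su].
  rewrite [komega 1 _]komega1 ?subr_gt0// mulr1; congr komega; ring.
rewrite -(E a a0 (le_trans ab bu)) -(E b (le_trans a0 ab) bu).
rewrite (Rintegral_itvoo_split ab bu) ?addrK//.
exact: integrable_komega_rev.
Qed.

(** Integrating (f s - f u) (g s - g u) <= 0 in s, then in u, gives twice the claim. Two single
    integrations replace a double integral. *)
Lemma Rintegral_chebyshev (f g : R -> R) a b : a < b ->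
  let D := `]a, b[%classic in
  mu.-integrable D (EFin \o f) -> mu.-integrable D (EFin \o g) ->
  mu.-integrable D (EFin \o (f \* g)) ->
  (forall s u, D s -> D u -> (f s - f u) * (g s - g u) <= 0) ->
  (b - a) * \int[mu]_(s in D) (f s * g s) <=
    (\int[mu]_(s in D) f s) * (\int[mu]_(s in D) g s).
Proof.
move=> ab D If Ig Ifg anti.
have mD : measurable D by exact: measurable_itv.
have IZ (h : R -> R) c : mu.-integrable D (EFin \o h) ->
    mu.-integrable D (EFin \o (fun s => c * h s)).
  by move=> Ih; have := @integrableZl _ _ _ mu D mD c _ Ih.
have Ic c : mu.-integrable D (EFin \o cst c).
  exact: integrable_cst_itv.
have ID (h k : R -> R) : mu.-integrable D (EFin \o h) ->
    mu.-integrable D (EFin \o k) -> mu.-integrable D (EFin \o (fun s => h s + k s)).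
  by move=> Ih Ik; have := @integrableD _ _ _ mu D mD _ _ Ih Ik.
have RZ (h : R -> R) c : mu.-integrable D (EFin \o h) ->
    \int[mu]_(s in D) (c * h s) = c * \int[mu]_(s in D) h s.
  by move=> Ih; rewrite RintegralZl.
set F := \int[mu]_(s in D) f s; set G := \int[mu]_(s in D) g s.
set H := \int[mu]_(s in D) (f s * g s).
have Icst c : \int[mu]_(s in D) (cst c s) = c * (b - a).
  exact/Rintegral_cst_itv/ltW.
have pt u : D u -> H + (b - a) * (f u * g u) <= f u * G + g u * F.
  move=> Du.
  rewrite -(RZ _ (g u) If) -(RZ _ (f u) Ig).
  rewrite [_ * (f u * g u)]mulrC -Icst -RintegralD//.
  rewrite -RintegralD//; last 2 first.
  - exact: IZ.
  - exact: IZ.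
  apply: le_Rintegral => //; [exact: ID|apply: ID; exact: IZ|].
  move=> s Ds /=; rewrite -subr_le0 (le_trans _ (anti s u Ds Du))//.
  by rewrite le_eqVlt; apply/orP; left; apply/eqP; ring.
have : \int[mu]_(u in D) (cst H u + (b - a) * (f u * g u)) <=
    \int[mu]_(u in D) (G * f u + F * g u).
  apply: le_Rintegral => //; [apply: ID => //; exact: IZ|apply: ID; exact: IZ|].
  by move=> u Du; rewrite /= [G * _]mulrC [F * _]mulrC pt.
rewrite RintegralD//; last exact: IZ.
rewrite RintegralD//; [|exact: IZ|exact: IZ].
rewrite Icst (RZ _ _ Ifg) (RZ _ _ If) (RZ _ _ Ig) -/H -/G -/F.
by rewrite [G * F]mulrC [H * _]mulrC -!mulr2n lerMn2r.
Qed.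

End kernel_integrals.

(** * The discrete Caputo derivative *)

Section abel.
Context {R : realFieldType}.
Implicit Types a d : nat -> R.

(** Abel summation: the left side is a_n d_(n+1) minus a_0 d_0 and minus the terms (a_k - a_(k-1))
    d_k, all nonnegative. It serves both the maximum principle and the energy estimate. *)
Lemma sum_nondecreasing_diff_le a d n :
  (forall k, (k <= n)%N -> 0 <= a k) ->
  (forall k, (k < n)%N -> a k <= a k.+1) ->
  (forall k, (k <= n)%N -> 0 <= d k) ->
  \sum_(0 <= k < n.+1) a k * (d k.+1 - d k) <= a n * d n.+1.
Proof.
elim: n => [|n IHn] a0 anD d0.
  by rewrite big_nat1 mulrBr lerBlDr lerDl mulr_ge0 ?a0 ?d0.
rewrite big_nat_recr//=.
have le1 : \sum_(0 <= k < n.+1) a k * (d k.+1 - d k) <= a n * d n.+1.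
  by apply: IHn => k kn; [apply: a0|apply: anD|apply: d0]; exact: ltnW.
have := ler_wpM2r (d0 n.+1 (leqnn _)) (anD n (ltnSn n)).
by rewrite mulrBr; lra.
Qed.

Lemma discrete_maximum_principle a d n :
  (forall k, (k <= n)%N -> 0 <= a k) ->
  (forall k, (k < n)%N -> a k <= a k.+1) ->
  0 < a n ->
  (forall k, (k <= n)%N -> 0 <= d k) ->
  0 <= \sum_(0 <= k < n.+1) a k * (d k.+1 - d k) -> 0 <= d n.+1.
Proof.
move=> a0 anD an d0 S0; rewrite -(pmulr_rge0 _ an).
exact: le_trans S0 (sum_nondecreasing_diff_le a0 anD d0).
Qed.

End abel.

Lemma ltS_ler (R : numDomainType) (T : nat -> R) n :
  (forall k, (k < n)%N -> T k < T k.+1) ->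
  forall j k, (j <= k <= n)%N -> T j <= T k.
Proof.
move=> Tincr j k /andP[jk kn]; elim: k jk kn => [|k IHk].
  by rewrite leqn0 => /eqP->.
rewrite leq_eqVlt => /predU1P[->//|jk] kn.
by rewrite (le_trans (IHk jk (ltnW kn)))// ltW// Tincr.
Qed.

Section discrete_caputo.
Context {R : realType}.
Local Notation mu := (@lebesgue_measure R).
Variables (alpha : R) (T : nat -> R).

(* [acoef n k] is the coefficient a^{(n)}_{n-k-1}, attached to the step from
   [T k] to [T k.+1]. *)
Definition acoef (n k : nat) : R :=
  (omega (2 - alpha) (T n - T k) - omega (2 - alpha) (T n - T k.+1)) / (T k.+1 - T k).

Definition dcaputo (v : nat -> R) (n : nat) : R :=
  \sum_(0 <= k < n) acoef n k * (v k.+1 - v k).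

Variable n : nat.
Hypotheses (alpha01 : 0 < alpha < 1) (T0 : T 0%N = 0)
  (Tincr : forall k, (k < n)%N -> T k < T k.+1).

Let alpha0 : 0 < alpha. Proof. by case/andP: alpha01. Qed.
Let oma0 : 0 < 1 - alpha. Proof. by rewrite subr_gt0; case/andP: alpha01. Qed.
Let oma1 : 1 - alpha <= 1. Proof. by rewrite gerBl ltW. Qed.

Let Tle j k : (j <= k <= n)%N -> T j <= T k.
Proof. exact: ltS_ler Tincr j k. Qed.

Let Tge0 k : (k <= n)%N -> 0 <= T k.
Proof. by move=> kn; rewrite -T0 Tle. Qed.

Let Tltn k : (k < n)%N -> T k < T n.
Proof. by move=> kn; rewrite (lt_le_trans (Tincr kn))// Tle// kn leqnn. Qed.

Let ker s : R := komega (1 - alpha) (T n - s).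

Let integrable_ker k : (k < n)%N ->
  mu.-integrable `]T k, T k.+1[ (EFin \o ker).
Proof. by move=> kn; apply: integrable_komega_rev => //; exact/Tge0/ltnW. Qed.

(** As a mean of the kernel over one step, the coefficient inherits sign and monotonicity from the
    kernel. *)
Lemma acoefE k : (k < n)%N ->
  acoef n k = (\int[mu]_(s in `]T k, T k.+1[) ker s) / (T k.+1 - T k).
Proof.
move=> kn; have Tkn : T k.+1 <= T n by rewrite Tle// kn leqnn.
rewrite /acoef (Rintegral_komega_rev oma0 (Tge0 (ltnW kn)) (ltW (Tincr kn)) Tkn).
by rewrite addrA.
Qed.

Lemma acoef_ge0 k : (k < n)%N -> 0 <= acoef n k.
Proof.
move=> kn; rewrite acoefE// divr_ge0 ?subr_ge0 ?(ltW (Tincr kn))//.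
by apply: Rintegral_ge0 => s _; exact: komega_ge0.
Qed.

(** The kernel increases in s, so its value at the common node [T k.+1] separates the means over the
    two adjacent steps. *)
Lemma acoef_nondecreasing k : (k.+1 < n)%N -> acoef n k <= acoef n k.+1.
Proof.
move=> kn; have kn' := ltnW kn.
apply: (@le_trans _ _ (ker (T k.+1))).
  rewrite acoefE// ler_pdivrMr ?subr_gt0 ?Tincr// -Rintegral_cst_itv ?(ltW (Tincr _))//.
  apply: le_Rintegral;
    [exact: measurable_itv|exact: integrable_ker|exact: integrable_cst_itv|].
  move=> s /=; rewrite in_itv/= => /andP[_ sk].
  by apply: ler_komega_lt1; rewrite ?oma0 ?oma1 ?subr_gt0 ?Tltn// lerD2l lerN2 ltW.
rewrite acoefE// ler_pdivlMr ?subr_gt0 ?Tincr// -Rintegral_cst_itv ?(ltW (Tincr _))//.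
apply: le_Rintegral; [exact: measurable_itv|exact: integrable_cst_itv|exact: integrable_ker|].
move=> s /=; rewrite in_itv/= => /andP[ks sk].
apply: ler_komega_lt1; rewrite ?oma0 ?oma1 ?subr_gt0//.
  by rewrite (lt_le_trans sk)// Tle// kn leqnn.
by rewrite lerD2l lerN2 ltW.
Qed.

Lemma acoef_last_gt0 k : n = k.+1 -> 0 < acoef n k.
Proof.
move=> nk; have kn : (k < n)%N by rewrite nk.
rewrite /acoef {2}nk subrr omega0 ?subr0; last first.
  by rewrite -subr_eq0 (_ : 2 - alpha - 1 = 1 - alpha) ?gt_eqF//; ring.
rewrite divr_gt0 ?subr_gt0 ?Tincr// omega_gt0 ?subr_gt0 ?Tltn//.
by move: oma0; lra.
Qed.

Lemma Rintegral_mesh (h : R -> R) j : (j <= n)%N ->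
  mu.-integrable `]0, T j[ (EFin \o h) ->
  \int[mu]_(s in `]0, T j[) h s =
  \sum_(0 <= k < j) \int[mu]_(s in `]T k, T k.+1[) h s.
Proof.
elim: j => [|j IHj] jn hi; first by rewrite big_nil T0 set_itvoo0 Rintegral_set0.
rewrite big_nat_recr//= (@Rintegral_itvoo_split _ h 0 (T j))//.
- rewrite IHj//; first exact: ltnW.
  apply: integrableS hi; [exact: measurable_itv|exact: measurable_itv|].
  by apply: subset_itvl; rewrite bnd_simp ltW// Tincr.
- exact/Tge0/ltnW.
- exact/ltW/Tincr.
Qed.

Lemma dcaputo_omega_concave y : (0 < n)%N -> 0 < y <= 1 ->
  omega (1 - alpha + y) (T n) <= dcaputo (fun k => omega (1 + y) (T k)) n.
Proof.
move=> n0 /andP[y0 y1]; rewrite -Rintegral_komega_conv//; last by rewrite -T0 Tltn.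
rewrite (@Rintegral_mesh _ n)//; last first.
  exact: integrableS (integrable_komega_conv _ oma0 y0).
rewrite /dcaputo big_nat_cond [leRHS]big_nat_cond.
apply: ler_sum => k /andP[/andP[_ kn] _].
have kT := Tincr kn; have k0 := Tge0 (ltnW kn).
rewrite acoefE// -Rintegral_komega ?(ltW kT)//.
(* The increment of omega_(1+y) is the integral of omega_y; after multiplication by the step length
   the claim is Chebyshev's inequality on this step. *)
rewrite mulrAC ler_pdivlMr ?subr_gt0// mulrC.
apply: Rintegral_chebyshev => //.
- exact: integrable_ker.
- exact: integrable_komega.
- exact: integrableS (integrable_komega_conv _ oma0 y0).
- have Tk : T k.+1 <= T n by rewrite Tle// kn leqnn.
  have wlog_anti s u : T k < s -> u < T k.+1 -> s <= u ->
      (ker s - ker u) * (komega y s - komega y u) <= 0.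
    move=> ks uk su; rewrite mulr_le0_ge0// ?subr_le0 ?subr_ge0.
      apply: ler_komega_lt1; rewrite ?oma0 ?oma1 ?subr_gt0 ?(lt_le_trans uk)//.
      by rewrite lerD2l lerN2.
    by apply: ler_komega_lt1; rewrite ?y0 ?y1// (le_lt_trans k0).
  move=> s u /=; rewrite !in_itv/= => /andP[ks sk] /andP[ku uk].
  have [su|us] := leP s u; first exact: wlog_anti.
  by rewrite -[leLHS]mulrNN !opprB; exact: wlog_anti (ltW us).
Qed.

Lemma dcaputo_omega_convex y d : 1 <= y -> 0 <= d ->
  (forall k, (k < n)%N -> T k.+1 - T k <= d) ->
  komega (1 - alpha + y) (T n - d) <= dcaputo (fun k => omega (1 + y) (T k)) n.
Proof.
move=> y1 d0 Td; have y0 : 0 < y by exact: lt_le_trans y1.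
have term k : (k < n)%N ->
    0 <= acoef n k * (omega (1 + y) (T k.+1) - omega (1 + y) (T k)).
  move=> kn; rewrite mulr_ge0 ?acoef_ge0// subr_ge0 ler_omega ?nnegrE ?Tge0//.
  - by rewrite lerDl ltW.
  - exact: ltnW.
  - exact/ltW/Tincr.
have [Tnd|Tnd] := leP (T n - d) 0.
  rewrite komega_le0E// /dcaputo big_nat_cond sumr_ge0// => k /andP[/andP[_ kn] _].
  exact: term.
rewrite komegaE//.
have Iconv := integrable_komega_conv_shift (T n) d oma0 y0.
rewrite -Rintegral_komega_conv_shift//; last by rewrite -subr_gt0.
rewrite (@Rintegral_mesh _ n)//; last first.
  exact: integrableS Iconv.
rewrite /dcaputo big_nat_cond [leRHS]big_nat_cond.
apply: ler_sum => k /andP[/andP[_ kn] _].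
have kT := Tincr kn; have k0 := Tge0 (ltnW kn).
rewrite acoefE// mulrAC -mulrA -RintegralZr; [|exact: measurable_itv|exact: integrable_ker].
apply: le_Rintegral.
- exact: measurable_itv.
- exact: integrableS Iconv.
- pose c := (omega (1 + y) (T k.+1) - omega (1 + y) (T k)) / (T k.+1 - T k).
  apply: (@eq_integrable _ _ _ mu _ (measurable_itv _)
    (fun s => c%:E * (EFin \o ker) s)%E).
    by move=> s _; rewrite /= -EFinM [c * _]mulrC.
  by apply: integrableZl => //; exact: integrable_ker.
move=> s /=; rewrite in_itv/= => /andP[ks sk].
apply: ler_wpM2l; first exact: komega_ge0.
rewrite ler_pdivlMr ?subr_gt0// -Rintegral_komega ?(ltW kT)//.
rewrite -Rintegral_cst_itv ?(ltW kT)//.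
apply: le_Rintegral;
  [exact: measurable_itv|exact: integrable_cst_itv|exact: integrable_komega|].
move=> u /=; rewrite in_itv/= => /andP[ku uk].
(* Two points s, u of one step differ by at most [d], so s - d <= u. *)
by apply: ler_komega => //; have := Td k kn; lra.
Qed.

End discrete_caputo.

(** * Delay Gronwall inequality *)

Section mittag_leffler.
Context {R : realType}.
Implicit Types (alpha z : R).

Let ml alpha z (i : nat) : R := z ^+ i / Gamma (i%:R * alpha + 1).

Let Gamma_ml_gt0 alpha i : 0 < alpha -> 0 < Gamma (i%:R * alpha + 1).
Proof. by move=> a0; rewrite Gamma_gt0// ltr_wpDl// mulr_ge0// ltW. Qed.

Let ml_ge0 alpha z i : 0 < alpha -> 0 <= z -> 0 <= ml alpha z i.
Proof. by move=> a0 z0; rewrite divr_ge0 ?exprn_ge0// ltW// Gamma_ml_gt0. Qed.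

(* [Gamma (1 + y) >= A `^ y * exp (- (A + 1))] for every [A]; with
   [A `^ alpha = 2 z] the series is dominated by a geometric one. *)
Let is_cvg_ml alpha z : 0 < alpha -> 0 < z -> cvgn (series (ml alpha z)).
Proof.
move=> a0 z0.
pose A := (2 * z) `^ alpha^-1.
have A0 : 0 < A by apply: powR_gt0; exact: mulr_gt0.
have Aa : A `^ alpha = 2 * z.
  by rewrite -powRrM mulVf ?gt_eqF// powRr1// mulr_ge0// ltW.
apply: (@series_le_cvg _ _ (geometric (expR (A + 1)) 2^-1)).
- by move=> i; apply: ml_ge0 => //; exact: ltW.
- by move=> i; rewrite /geometric/= mulr_ge0 ?expR_ge0// exprn_ge0.
- move=> i; rewrite /geometric/= /ml ler_pdivrMr ?Gamma_ml_gt0//.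
  have ia0 : 0 <= i%:R * alpha by rewrite mulr_ge0// ltW.
  have := Gamma1D_ge A0 ia0; rewrite [1 + _]addrC [A `^ _ * _]mulrC powRrM.
  rewrite [A `^ _ `^ _]powRAC Aa powR_mulrn ?mulr_ge0 ?(ltW z0)// expRN => Gge.
  apply: (@le_trans _ _ (expR (A + 1) * 2^-1 ^+ i * ((expR (A + 1))^-1 * (2 * z) ^+ i))).
    rewrite exprMn exprVn le_eqVlt; apply/orP; left; apply/eqP.
    by field; rewrite gt_eqF ?expR_gt0// expf_neq0.
  rewrite ler_wpM2l ?mulr_ge0 ?expR_ge0 ?exprn_ge0//.
- apply: is_cvg_geometric_series.
  by rewrite gtr0_norm ?invf_lt1// ?invr_gt0// ltr1n.
Qed.

(** Keeping [y] and [z] apart builds in the monotonicity of E, through which larger constants can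
    enter its argument. *)
Lemma sum_le_mittag_leffler alpha y z n : 0 < alpha -> 0 <= y -> y <= z ->
  \sum_(0 <= i < n) y ^+ i / Gamma (i%:R * alpha + 1) <= mittag_leffler alpha z.
Proof.
move=> a0 y0 yz.
have z0 : 0 <= z by exact: le_trans yz.
apply: (@le_trans _ _ (series (ml alpha z) n)).
  rewrite /series/=; apply: ler_sum => i _.
  by rewrite ler_pM2r ?invr_gt0 ?Gamma_ml_gt0// lerXn2r ?nnegrE.
apply: nondecreasing_cvgn_le.
  by apply: nondecreasing_series => i _ _; exact: ml_ge0.
(* [is_cvg_ml] asks for a positive argument; at z = 0 the series at 1 dominates. *)
move: z0; rewrite le_eqVlt => /predU1P[z0|z0]; last exact: is_cvg_ml.
apply: (@series_le_cvg _ _ (ml alpha 1)).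
- by move=> i; apply: ml_ge0 => //; rewrite -z0.
- by move=> i; exact: ml_ge0.
- move=> i; rewrite ler_pM2r ?invr_gt0 ?Gamma_ml_gt0// lerXn2r ?nnegrE -?z0//.
- exact: is_cvg_ml.
Qed.

Lemma mittag_leffler_ge0 alpha z : 0 < alpha -> 0 <= z -> 0 <= mittag_leffler alpha z.
Proof.
move=> a0 z0; have := @sum_le_mittag_leffler alpha z z 0 a0 z0 (lexx _).
by rewrite big_nil.
Qed.

End mittag_leffler.

Section gronwall.
Context {R : realType}.
Local Notation mu := (@lebesgue_measure R).

(** In the convolution of omega_(1+x) with omega_y the first factor is at most its value at [u].
    This extracts omega_(1+alpha) from the part of the supersolution driven by the source. *)
Lemma omegaD_le (x y u : R) : 0 <= x -> 0 < y -> 0 < u ->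
  omega (1 + (x + y)) u <= omega (1 + x) u * omega (1 + y) u.
Proof.
move=> x0 y0 u0; have x10 : 0 < 1 + x by rewrite ltr_pwDl.
have -> : 1 + (x + y) = 1 + x + y by ring.
rewrite -Rintegral_komega_conv//.
have -> : omega (1 + y) u = \int[mu]_(s in `]0, u[) komega y s.
  rewrite Rintegral_komega ?(ltW u0)// omega0 ?subr0//.
  by rewrite -subr_eq0 addrAC subrr add0r gt_eqF.
rewrite -RintegralZl//; last exact: integrable_komega.
apply: le_Rintegral.
- exact: measurable_itv.
- exact: integrableS (integrable_komega_conv _ x10 y0).
- have := @integrableZl _ _ _ mu `]0, u[ (measurable_itv _) (omega (1 + x) u) _
    (integrable_komega 0 u y0).
  by apply: eq_integrable; [exact: measurable_itv|move=> s _; rewrite /= -EFinM].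
- move=> s /=; rewrite in_itv/= => /andP[s0 su].
  rewrite ler_wpM2r ?komega_ge0// komegaE ?subr_gt0//.
  by rewrite ler_omega ?nnegrE ?lerDl ?gerBl ?subr_ge0 ?(ltW su) ?(ltW s0) ?(ltW u0).
Qed.

Variables (alpha : R) (T : nat -> R) (nmax P : nat) (d : R).
Hypotheses (alpha01 : 0 < alpha < 1) (T0 : T 0%N = 0)
  (Tincr : forall k, (k < nmax)%N -> T k < T k.+1)
  (d0 : 0 <= d) (Td : forall k, (k < nmax)%N -> T k.+1 - T k <= d)
  (TP : forall n, (P <= n <= nmax)%N -> T (n - P) <= T n - d).
Variable c : R.
Hypothesis c0 : 0 <= c.

Let alpha0 : 0 < alpha. Proof. by case/andP: alpha01. Qed.
Let alpha1 : alpha <= 1. Proof. by rewrite ltW//; case/andP: alpha01. Qed.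

Let Tincrn n : (n <= nmax)%N -> forall k, (k < n)%N -> T k < T k.+1.
Proof. by move=> nn k kn; exact/Tincr/(leq_trans kn). Qed.

Let Tle j k : (j <= k <= nmax)%N -> T j <= T k.
Proof. exact: ltS_ler Tincr j k. Qed.

Let Tgt0 k : (0 < k <= nmax)%N -> 0 < T k.
Proof.
move=> /andP[k0 kn]; rewrite -T0 (@lt_le_trans _ _ (T 1))//.
  by rewrite Tincr// (leq_trans k0).
by rewrite Tle// k0.
Qed.

Let Tge0 k : (k <= nmax)%N -> 0 <= T k.
Proof. by move=> kn; rewrite -T0 Tle. Qed.

(** For y < 1, the condition alpha <= y makes omega_(1-alpha+y) nondecreasing, so its value at [T n]
    dominates the one at [T n - d]. *)
Lemma dcaputo_omega_ge y n : (0 < n <= nmax)%N -> alpha <= y ->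
  komega (1 - alpha + y) (T n - d) <= dcaputo alpha T (fun k => omega (1 + y) (T k)) n.
Proof.
move=> /[dup] n1 /andP[n0 nn] ya; have y0 : 0 < y by exact: lt_le_trans ya.
have [y1|y1] := leP 1 y.
  apply: dcaputo_omega_convex => //; first exact: Tincrn.
  by move=> k kn; apply: Td; exact: leq_trans nn.
have ay1 : 1 <= 1 - alpha + y by move: ya; lra.
have cc : omega (1 - alpha + y) (T n) <= dcaputo alpha T (fun k => omega (1 + y) (T k)) n.
  by apply: dcaputo_omega_concave => //; [exact: Tincrn|rewrite y0 ltW].
apply: le_trans cc; rewrite -komegaE ?Tgt0//.
by apply: ler_komega => //; rewrite gerBl.
Qed.

(** For y = 0 a partial sum of E_{alpha,1}(c s^alpha), the response to the initial value; for y =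
    alpha the response to a constant source. *)
Definition msum (y : R) (M : nat) (s : R) : R :=
  \sum_(0 <= m < M) c ^+ m * omega (1 + (m%:R * alpha + y)) s.

Lemma dcaputo_msum y M n : dcaputo alpha T (fun k => msum y M (T k)) n =
  \sum_(0 <= m < M) c ^+ m * dcaputo alpha T (fun k => omega (1 + (m%:R * alpha + y)) (T k)) n.
Proof.
rewrite /dcaputo /msum.
under eq_bigr do rewrite -sumrB mulr_sumr.
rewrite exchange_big/=; apply: eq_bigr => m _.
rewrite mulr_sumr; apply: eq_bigr => k _; ring.
Qed.

(** Since 1 + (m alpha + y) = 1 - alpha + ((m+1) alpha + y), the term m + 1 yields [c] times the
    delayed term m. The case distinction replaces the cut-off of [komega]: [msum] need not vanish at
    arguments <= 0. *)
Lemma dcaputo_msumS y M n : (0 < n <= nmax)%N -> 0 <= y ->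
  dcaputo alpha T (fun k => omega (1 + y) (T k)) n +
    (if d < T n then c * msum y M (T n - d) else 0) <=
  dcaputo alpha T (fun k => msum y M.+1 (T k)) n.
Proof.
move=> n0 y0; rewrite dcaputo_msum big_nat_recl//= expr0 mul1r mul0r add0r lerD2l.
rewrite (_ : (if _ then _ else _) = \sum_(0 <= m < M) c ^+ m.+1 *
    komega (1 + (m%:R * alpha + y)) (T n - d)).
  apply: ler_sum => m _; rewrite ler_wpM2l ?exprn_ge0//.
  have -> : 1 + (m%:R * alpha + y) = 1 - alpha + (m.+1%:R * alpha + y).
    by rewrite -natr1; ring.
  apply: dcaputo_omega_ge => //.
  by rewrite -natr1 mulrDl mul1r -addrA addrCA lerDl addr_ge0// mulr_ge0// ltW.
case: ifPn => [dT|]; last first.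
  rewrite -leNgt => Td0; rewrite big1// => m _.
  by rewrite komega_le0E ?mulr0// subr_le0.
rewrite /msum mulr_sumr; apply: eq_bigr => m _.
by rewrite komegaE ?subr_gt0// exprS mulrA.
Qed.

Lemma msum_ge0 y M s : 0 <= y -> 0 <= msum y M s.
Proof.
move=> y0; apply: sumr_ge0 => m _; rewrite mulr_ge0 ?exprn_ge0// omega_ge0//.
by rewrite ltr_pwDl// addr_ge0// mulr_ge0// ltW.
Qed.

Lemma ler_msum y M : 0 <= y -> {in Num.nneg &, {homo msum y M : s u / s <= u}}.
Proof.
move=> y0 s u s0 u0 su; apply: ler_sum => m _; rewrite ler_wpM2l ?exprn_ge0//.
by apply: ler_omega => //; rewrite lerDl addr_ge0// mulr_ge0// ltW.
Qed.

Variables (w : nat -> R) (lam : nat -> nat -> R) (Z : R).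
Hypotheses (w0 : 0 <= w 0%N) (Z0 : 0 <= Z)
  (lam0 : forall n k, (P <= k < n)%N -> (n <= nmax)%N -> 0 <= lam n k)
  (lamc : forall n, (n <= nmax)%N -> \sum_(P <= k < n) lam n k <= c)
  (P0 : (0 < P)%N)
  (Dw : forall n, (0 < n <= nmax)%N ->
    dcaputo alpha T w n <= \sum_(P <= k < n) lam n k * w (k.+1 - P)%N + Z).

(* The truncation at [M] is a supersolution for [n <= M * P] only, since the
   delay term of [W M.+1] involves [W M]. *)
Let W M s : R := w 0%N * msum 0 M.+1 s + Z * msum alpha M.+1 s.

Let W_ge0 M s : 0 <= W M s.
Proof. by rewrite addr_ge0// mulr_ge0// msum_ge0// ltW. Qed.

Let ler_W M : {in Num.nneg &, {homo W M : s u / s <= u}}.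
Proof.
by move=> s u s0 u0 su; rewrite lerD// ler_wpM2l// ler_msum// ltW.
Qed.

(** The leading terms settle the rest: D kills the constant omega_1, and D omega_(1+alpha) >=
    omega_1 = 1 produces [Z]. *)
Let DW M n : (0 < n <= nmax)%N ->
  (if d < T n then c * W M (T n - d) else 0) + Z <=
  dcaputo alpha T (fun k => W M.+1 (T k)) n.
Proof.
move=> n0; have /andP[n1 nn] := n0.
have -> : dcaputo alpha T (fun k => W M.+1 (T k)) n =
    w 0%N * dcaputo alpha T (fun k => msum 0 M.+2 (T k)) n +
    Z * dcaputo alpha T (fun k => msum alpha M.+2 (T k)) n.
  rewrite /dcaputo !mulr_sumr -big_split/=; apply: eq_bigr => k _.
  rewrite /W; move: (msum _ _ _) (msum _ _ _) (msum _ _ _) (msum _ _ _) => x1 x2 x3 x4.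
  by move: (acoef _ _ _ _) (w _) => a w'; ring.
have h1 := dcaputo_msumS M.+1 n0 (lexx 0).
have h2 := dcaputo_msumS M.+1 n0 (ltW alpha0).
have D1 : dcaputo alpha T (fun k => omega (1 + 0) (T k)) n = 0.
  by rewrite /dcaputo big1// => k _; rewrite addr0 !omega1 subrr mulr0.
have Da : 1 <= dcaputo alpha T (fun k => omega (1 + alpha) (T k)) n.
  have al01 : 0 < alpha <= 1 by rewrite alpha0.
  have := dcaputo_omega_concave alpha01 T0 (Tincrn nn) n1 al01.
  by rewrite subrK omega1.
rewrite D1 add0r in h1.
have {}h2 := le_trans (lerD Da (lexx _)) h2.
apply: le_trans (lerD (ler_wpM2l w0 h1) (ler_wpM2l Z0 h2)).
rewrite [Z * (1 + _)]mulrDr mulr1 [leRHS]addrCA [leLHS]addrC lerD2l.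
by case: ifP => _; rewrite ?mulr0 ?addr0// /W mulrDr ![c * (_ * _)]mulrCA.
Qed.

Let W0_ge M : w 0%N <= W M 0.
Proof.
have m0 : 1 <= msum 0 M.+1 0.
  rewrite /msum big_nat_recl//= expr0 mul1r mul0r !addr0 omega1 lerDl.
  apply: sumr_ge0 => m _; rewrite mulr_ge0 ?exprn_ge0// omega_ge0//.
  by rewrite ltr_pwDl// addr_ge0// mulr_ge0// ltW.
rewrite -[leLHS]addr0; apply: lerD; first exact: ler_peMr.
exact: mulr_ge0 Z0 (msum_ge0 _ _ (ltW alpha0)).
Qed.

(** Outer induction on windows of [P] steps, inner induction in time by the maximum principle.
    Delayed indices of the window [M.+1] satisfy the bound [M * P], so the outer hypothesis controls
    them by [W M]. *)
Lemma le_supersolution M n : (n <= nmax)%N -> (n <= M * P)%N -> w n <= W M (T n).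
Proof.
elim: M n => [|M IHM] n.
  by rewrite mul0n leqn0 => _ /eqP ->; rewrite T0.
elim/ltn_ind: n => -[|n] IHn nn nM; first by rewrite T0.
have nn1 : (0 < n.+1 <= nmax)%N by rewrite nn.
rewrite -subr_ge0.
have Tn := Tincrn nn.
apply: (@discrete_maximum_principle _ (acoef alpha T n.+1)
    (fun k => W M.+1 (T k) - w k) n).
- by move=> k kn; exact: acoef_ge0.
- by move=> k kn; exact: acoef_nondecreasing.
- exact: acoef_last_gt0.
- move=> k kn; rewrite subr_ge0; apply: IHn => //; first exact: leq_trans kn (ltnW nn).
  exact: leq_trans kn (ltnW nM).
have -> : \sum_(0 <= k < n.+1) acoef alpha T n.+1 k *
      (W M.+1 (T k.+1) - w k.+1 - (W M.+1 (T k) - w k)) =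
    dcaputo alpha T (fun k => W M.+1 (T k)) n.+1 - dcaputo alpha T w n.+1.
  by rewrite /dcaputo -sumrB; apply: eq_bigr => k _; ring.
rewrite subr_ge0; apply: le_trans (Dw nn1) _; apply: le_trans (DW M nn1).
rewrite lerD2r.
have [nP|Pn] := leqP n.+1 P.
  by rewrite big_geq//; case: ifP => // _; rewrite mulr_ge0.
have TPn : T (n.+1 - P) <= T n.+1 - d by rewrite TP// nn (ltnW Pn).
have TnP0 : 0 < T (n.+1 - P).
  by rewrite Tgt0// subn_gt0 Pn (leq_trans (leq_subr _ _)).
(* 0 < T (n.+1 - P) <= T n.+1 - d selects the branch with the delay term. *)
rewrite ifT; last by rewrite -subr_gt0 (lt_le_trans TnP0).
apply: (@le_trans _ _ (\sum_(P <= k < n.+1) lam n.+1 k * W M (T n.+1 - d))); last first.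
  by rewrite -mulr_suml ler_wpM2r// lamc.
rewrite big_nat_cond [leRHS]big_nat_cond.
apply: ler_sum => k /andP[/andP[Pk kn] _]; rewrite ler_wpM2l ?lam0 ?Pk//.
have kP : (k.+1 - P <= n.+1 - P)%N by rewrite leq_sub2r.
have knm : (k.+1 - P <= nmax)%N.
  by rewrite (leq_trans kP)// (leq_trans (leq_subr _ _)).
apply: (@le_trans _ _ (W M (T (k.+1 - P)))).
  apply: IHM => //; apply: (leq_trans kP).
  by rewrite leq_subLR -mulSn.
apply: ler_W; rewrite ?nnegrE ?Tge0//.
  by rewrite (le_trans _ TPn)// ltW.
apply: le_trans TPn; apply: Tle.
by rewrite kP (leq_trans (leq_subr _ _)).
Qed.

Lemma delay_gronwall n z : (0 < n <= nmax)%N -> c * T n `^ alpha <= z ->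
  w n <= mittag_leffler alpha z * (w 0%N + Z * omega (1 + alpha) (T n)).
Proof.
move=> /[dup] n0 /andP[n1 nn] cz; have Tn := Tgt0 n0.
(* Since P >= 1, the truncation level M = n reaches the index n. *)
apply: (le_trans (@le_supersolution n n nn _)); first by rewrite leq_pmulr.
rewrite /W mulrC.
have S0 : msum 0 n.+1 (T n) <= mittag_leffler alpha z.
  apply: le_trans (@sum_le_mittag_leffler _ alpha (c * T n `^ alpha) z n.+1 alpha0 _ cz).
    apply: ler_sum => i _; rewrite addr0 /omega addrAC subrr add0r.
    rewrite exprMn -mulrA [1 + _]addrC -(powR_mulrn _ (powR_ge0 (T n) alpha)) -powRrM.
    by rewrite [alpha * _]mulrC.
  by rewrite mulr_ge0 ?powR_ge0.
have Sa : msum alpha n.+1 (T n) <= msum 0 n.+1 (T n) * omega (1 + alpha) (T n).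
  rewrite /msum mulr_suml; apply: ler_sum => i _.
  rewrite -mulrA ler_wpM2l ?exprn_ge0// addr0 omegaD_le//.
  by rewrite mulr_ge0// ltW.
have o0 : 0 <= omega (1 + alpha) (T n) by rewrite omega_ge0// ltr_pwDl// ltW.
apply: (@le_trans _ _ (msum 0 n.+1 (T n) * (w 0%N + Z * omega (1 + alpha) (T n)))).
  by rewrite mulrDr lerD2l mulrCA ler_wpM2l.
by rewrite ler_wpM2r// addr_ge0// mulr_ge0.
Qed.

End gronwall.

(** * The symmetric graded mesh *)

Section mesh.
Context {R : realType}.
Variables (tau r : R) (N K : nat) (t : int -> R).
Hypotheses (tau0 : 0 < tau) (r1 : 1 < r) (N2 : (2 <= N)%N)
  (ht : symmetric_graded_mesh tau r N K t).

Let T (k : nat) : R := t k%:Z.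

(** Offset of the j-th node within one delay period: graded towards both ends, with the two branches
    meeting at tau / 2 for j = N. *)
Let g (j : nat) : R :=
  if (j < N)%N then tau / 2 * (j%:R / N%:R) `^ r
  else tau - tau / 2 * ((2 * N - j)%:R / N%:R) `^ r.

Let N0 : 0 < N%:R :> R. Proof. by rewrite ltr0n (ltn_trans _ N2). Qed.
Let r0 : 0 < r. Proof. exact: lt_trans r1. Qed.
Let t20 : 0 < tau / 2. Proof. by rewrite divr_gt0. Qed.

Let T_block q : (q <= K)%N -> T (2 * q * N) = q%:R * tau.
Proof.
rewrite /T => qK; have [_ /(_ q (2 * q * N)%:Z qK) [_ ->]] := ht; last by lia.
rewrite (_ : (2 * q%:Z * N%:Z - (2 * q * N)%:Z) = 0)%R; last by lia.
by rewrite mul0r powR0 ?gt_eqF// mulr0 add0r.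
Qed.

Let TE q j : (q < K)%N -> (j <= 2 * N)%N -> T (2 * q * N + j) = q%:R * tau + g j.
Proof.
move=> qK j2N.
have [_ /(_ q.+1 (2 * q * N + j)%:Z qK)[h1 h2]] := ht.
rewrite /T /g; case: ltnP => jN.
  (* The first range in the mesh definition starts one node late; j = 0 is the last node of the
     preceding period. *)
  case: j j2N jN h1 h2 => [|j] j2N jN h1 h2.
    by rewrite addn0 mul0r powR0 ?gt_eqF// mulr0 addr0; exact/T_block/ltnW.
  rewrite h1; last by lia.
  rewrite (_ : ((2 * q * N + j.+1)%:Z - 2 * (q.+1%:Z - 1) * N%:Z) = j.+1%:Z)%R; last by lia.
  by rewrite addrC; congr (_ * _ + _); rewrite -natr1 addrK.
rewrite h2; last by lia.
rewrite (_ : (2 * q.+1%:Z * N%:Z - (2 * q * N + j)%:Z) = (2 * N - j)%N%:Z)%R; last by lia.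
by rewrite -natr1 mulNr; move: (_ `^ _) => X; rewrite pmulrn; ring.
Qed.

Let g_lt j : (j < 2 * N)%N -> g j < g j.+1.
Proof.
move=> j2N; rewrite /g.
have pw (a b : nat) : (a < b)%N -> (a%:R / N%:R) `^ r < (b%:R / N%:R) `^ r :> R.
  move=> ab; apply: gt0_ltr_powR => //; rewrite ?nnegrE ?divr_ge0 ?(ltW N0)//.
  by rewrite ltr_pM2r ?invr_gt0// ltr_nat.
case: (ltnP j N) => jN; case: (ltnP j.+1 N) => jN1.
- by rewrite ltr_pM2l// pw.
- have -> : (2 * N - j.+1 = N)%N by lia.
  rewrite divff ?gt_eqF// powR1 mulr1.
  have := pw j N jN; rewrite divff ?gt_eqF// powR1 => h.
  have := ltr_pM2l t20 _ 1; rewrite mulr1 => hh.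
  by have := hh ((j%:R / N%:R) `^ r); rewrite h; lra.
- by lia.
- rewrite ltrD2l ltrN2 ltr_pM2l// pw//; lia.
Qed.

Let g0 : g 0 = 0.
Proof. by rewrite /g ltnW// mul0r powR0 ?gt_eqF// mulr0. Qed.

Let g2N : g (2 * N) = tau.
Proof.
rewrite /g ifF; last by lia.
by rewrite subnn mul0r powR0 ?gt_eqF// mulr0 subr0.
Qed.

Let g_le i j : (i <= j)%N -> (j <= 2 * N)%N -> g i <= g j.
Proof.
elim: j => [|j IHj]; first by rewrite leqn0 => /eqP ->.
rewrite leq_eqVlt => /predU1P[->//|ij] jN.
exact: le_trans (IHj ij (ltnW jN)) (ltW (g_lt jN)).
Qed.

Let decomp k : (k < 2 * K * N)%N ->
  exists q j, [/\ (q < K)%N, (j < 2 * N)%N & k = (2 * q * N + j)%N].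
Proof.
move=> kKN; exists (k %/ (2 * N))%N, (k %% (2 * N))%N; split.
- by rewrite ltn_divLR; [rewrite mulnA [(K * 2)%N]mulnC|lia].
- by rewrite ltn_mod; lia.
- by rewrite {1}(divn_eq k (2 * N)); lia.
Qed.

Lemma mesh0 : t 0 = 0.
Proof. by have := T_block (leq0n K); rewrite /T muln0 mul0n mul0r. Qed.

Lemma mesh_incr k : (k < 2 * K * N)%N -> t k%:Z < t k.+1%:Z.
Proof.
rewrite -/(T k) -/(T k.+1) => /decomp[q [j [qK jN ->]]].
by rewrite -addnS !TE ?(ltnW jN)// ltrD2l g_lt.
Qed.

Lemma mesh_step_le k : (k < 2 * K * N)%N -> t k.+1%:Z - t k%:Z <= tau.
Proof.
rewrite -/(T k) -/(T k.+1) => /decomp[q [j [qK jN ->]]].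
rewrite -addnS !TE ?(ltnW jN)//.
have := g_le jN (leqnn _); have := g_le (leq0n j) (ltnW jN).
by rewrite g0 g2N; lra.
Qed.

Lemma mesh_delay n : (2 * N <= n <= 2 * K * N)%N -> t (n - 2 * N)%N%:Z = t n%:Z - tau.
Proof.
rewrite -/(T n) -/(T (n - 2 * N)) => /andP[Nn nK].
have h : (n - 2 * N < 2 * K * N)%N by lia.
have [q [j [qK jN e]]] := decomp h.
rewrite e.
have -> : n = (2 * q.+1 * N + j)%N by lia.
rewrite TE ?(ltnW jN)//.
have [qK1|Kq] := ltnP q.+1 K.
  by rewrite TE ?(ltnW jN)// -natr1; ring.
(* Here n is the final node 2KN, which starts no further period; [T_block] gives its value. *)
have j0 : j = 0%N by nia.
by rewrite j0 addn0 T_block// g0 -natr1; ring.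
Qed.

Lemma mesh_final : t (2 * K * N)%N%:Z = K%:R * tau.
Proof. exact: T_block. Qed.

End mesh.

(** * The energy estimate *)

Section bounded_measurable.
Context {R : realType}.
Local Notation mu := (@lebesgue_measure R).
Variable L : R.
Local Notation D := (`]0%R, L[%classic : set R).
Implicit Types v w : R -> R.

(** On a bounded interval this class is closed under products and consists of integrable functions,
    so bilinearity of [inner] needs no further integrability checks. *)
Definition bounded_measurable v : Prop :=
  measurable_fun D v /\ exists M : R, forall x, D x -> `|v x| <= M.

Lemma bounded_measurable_eq v w : {in D, v =1 w} ->
  bounded_measurable v -> bounded_measurable w.
Proof.
move=> vw [mv [M vM]]; split; first exact: eq_measurable_fun vw mv.
by exists M => x Dx; rewrite -vw ?inE//; exact: vM.
Qed.

Lemma bounded_measurable_cst (c : R) : bounded_measurable (fun=> c).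
Proof. by split; [exact: measurable_cst|exists `|c|]. Qed.

Lemma bounded_measurableD v w : bounded_measurable v -> bounded_measurable w ->
  bounded_measurable (fun x => v x + w x).
Proof.
move=> [mv [M vM]] [mw [M' wM]]; split; first exact: measurable_funD.
exists (M + M') => x Dx; apply: le_trans (ler_normD _ _) _.
by rewrite lerD// ?vM ?wM.
Qed.

Lemma bounded_measurableM v w : bounded_measurable v -> bounded_measurable w ->
  bounded_measurable (fun x => v x * w x).
Proof.
move=> [mv [M vM]] [mw [M' wM]]; split; first exact: measurable_funM.
by exists (M * M') => x Dx; rewrite normrM ler_pM ?vM ?wM.
Qed.

Lemma bounded_measurable_integrable v : bounded_measurable v ->
  mu.-integrable D (EFin \o v).
Proof.
move=> [mv [M vM]].
have muD : (mu D < +oo)%E.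
  by rewrite lebesgue_measure_itv/=; case: ifP; rewrite ?ltry// -EFinB ltry.
apply: (@measurable_bounded_integrable _ _ _ mu v _ (measurable_itv _) _ mv).
- exact: muD.
- exists M; split; first exact: num_real.
  by move=> y My x Dx; exact: le_trans (vM x Dx) (ltW My).
Qed.

Lemma bounded_measurable_continuous v : {within `[0, L], continuous v} ->
  bounded_measurable v.
Proof.
move=> cv; split.
  apply: (@measurable_funS _ _ _ _ `[0, L]%classic).
  - exact: measurable_itv.
  - exact: subset_itv_oo_cc.
  by apply: subspace_continuous_measurable_fun => //; exact: measurable_itv.
have /compact_bounded : compact (v @` `[0, L]%classic).
  by apply: continuous_compact => //; exact: segment_compact.
move=> /ex_strict_bound_gt0[k k0 vk]; exists k => x Dx.
by apply/ltW/vk; exists x => //; exact: subset_itv_oo_cc.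
Qed.

Lemma innerC v w : inner L v w = inner L w v.
Proof. by apply: eq_Rintegral => x _; rewrite mulrC. Qed.

Lemma eq_inner v v' w w' : {in D, v =1 v'} -> {in D, w =1 w'} ->
  inner L v w = inner L v' w'.
Proof. by move=> vv ww; apply: eq_Rintegral => x xD; rewrite vv ?ww. Qed.

Lemma innerZl (c : R) v w : bounded_measurable v -> bounded_measurable w ->
  inner L (fun x => c * v x) w = c * inner L v w.
Proof.
move=> bv bw; rewrite /inner -RintegralZl; last 2 first.
- exact: measurable_itv.
- exact/bounded_measurable_integrable/bounded_measurableM.
by apply: eq_Rintegral => x _; rewrite mulrA.
Qed.

Lemma innerDl v v' w : bounded_measurable v -> bounded_measurable v' ->
  bounded_measurable w -> inner L (fun x => v x + v' x) w = inner L v w + inner L v' w.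
Proof.
move=> bv bv' bw; rewrite /inner -RintegralD; last 3 first.
- exact: measurable_itv.
- exact/bounded_measurable_integrable/bounded_measurableM.
- exact/bounded_measurable_integrable/bounded_measurableM.
by apply: eq_Rintegral => x _; rewrite mulrDl.
Qed.

Lemma bounded_measurableZ (c : R) v : bounded_measurable v ->
  bounded_measurable (fun x => c * v x).
Proof. by move=> bv; apply: bounded_measurableM => //; exact: bounded_measurable_cst. Qed.

Lemma bounded_measurable_sum (m n : nat) (c : nat -> R) (v : nat -> R -> R) :
  (forall k, (m <= k < n)%N -> bounded_measurable (v k)) ->
  bounded_measurable (fun x => \sum_(m <= k < n) c k * v k x).
Proof.
elim: n => [|n IHn] bv.
  apply: (@bounded_measurable_eq (fun=> 0)); last exact: bounded_measurable_cst.
  by move=> x _; rewrite big_geq.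
have [mn|nm] := leqP m n; last first.
  apply: (@bounded_measurable_eq (fun=> 0)); last exact: bounded_measurable_cst.
  by move=> x _; rewrite big_geq.
apply: (@bounded_measurable_eq
    (fun x => \sum_(m <= k < n) c k * v k x + c n * v n x)).
  by move=> x _; rewrite big_nat_recr.
apply: bounded_measurableD.
  by apply: IHn => k /andP[mk kn]; apply: bv; rewrite mk ltnW.
by apply: bounded_measurableZ; apply: bv; rewrite mn leqnn.
Qed.

Lemma inner_suml (m n : nat) (c : nat -> R) (v : nat -> R -> R) w :
  (forall k, (m <= k < n)%N -> bounded_measurable (v k)) -> bounded_measurable w ->
  inner L (fun x => \sum_(m <= k < n) c k * v k x) w =
  \sum_(m <= k < n) c k * inner L (v k) w.
Proof.
move=> + bw; elim: n => [|n IHn] bv.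
  rewrite big_geq// (@eq_inner _ (fun x => 0 * w x) _ w)//.
    by rewrite innerZl// mul0r.
  by move=> x _; rewrite big_geq ?mul0r.
have [mn|nm] := leqP m n; last first.
  rewrite big_geq// (@eq_inner _ (fun x => 0 * w x) _ w)//.
    by rewrite innerZl// mul0r.
  by move=> x _; rewrite big_geq ?mul0r.
have bv' k : (m <= k < n)%N -> bounded_measurable (v k).
  by move=> /andP[mk kn]; apply: bv; rewrite mk ltnW.
have bvn : bounded_measurable (v n) by apply: bv; rewrite mn leqnn.
rewrite big_nat_recr//= -IHn// -innerZl// -innerDl//.
- by apply: eq_inner => // x _; rewrite big_nat_recr.
- exact: bounded_measurable_sum.
- exact: bounded_measurableZ.
Qed.

Lemma inner_ge0 v : 0 <= inner L v v.
Proof. by apply: Rintegral_ge0 => x _; rewrite -expr2 sqr_ge0. Qed.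

Lemma l2norm_ge0 v : 0 <= l2norm L v.
Proof. exact: sqrtr_ge0. Qed.

Lemma sqr_l2norm v : l2norm L v ^+ 2 = inner L v v.
Proof. by rewrite sqr_sqrtr// inner_ge0. Qed.

(** The form x^2 A + 2xyB + y^2 C is nonnegative. Its value at (C, -B) settles C > 0; if C = 0, its
    value at (B, -(A + 1)) is -B^2 (A + 2) and forces B = 0. *)
Lemma inner_cauchy_schwarz v w : bounded_measurable v -> bounded_measurable w ->
  `|inner L v w| <= l2norm L v * l2norm L w.
Proof.
move=> bv bw.
set A := inner L v v; set B := inner L v w; set C := inner L w w.
have q x y : 0 <= x ^+ 2 * A + 2 * (x * y * B) + y ^+ 2 * C.
  have := inner_ge0 (fun s => x * v s + y * w s).
  have bxv := bounded_measurableZ x bv; have byw := bounded_measurableZ y bw.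
  have bs := bounded_measurableD bxv byw.
  rewrite innerDl// !innerZl// [inner L v _]innerC [inner L w _]innerC !innerDl// !innerZl//.
  rewrite [inner L w v]innerC -/A -/B -/C => /le_trans; apply.
  by rewrite le_eqVlt; apply/orP; left; apply/eqP; ring.
have A0 : 0 <= A := inner_ge0 v; have C0 : 0 <= C := inner_ge0 w.
have BAC : B ^+ 2 <= A * C.
  move: C0; rewrite le_eqVlt => /predU1P[C0|C0].
    have := q B (- (A + 1)); rewrite -C0; nra.
  rewrite -subr_ge0 -(pmulr_rge0 _ C0) (le_trans (q C (- B)))//.
  by rewrite le_eqVlt; apply/orP; left; apply/eqP; ring.
by rewrite /l2norm -sqrtrM// -sqrtr_sqr ler_wsqrtr.
Qed.

Lemma bform_ge0 (p a : R) v : bounded_measurable v -> 0 <= p -> a <= 0 ->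
  0 <= bform p a L v v.
Proof.
move=> bv p0 a0; rewrite /bform innerZl// addr_ge0// ?mulr_ge0 ?inner_ge0//.
by rewrite oppr_ge0 mulr_le0_ge0 ?inner_ge0.
Qed.

End bounded_measurable.


(** * Regularity in space of the source term *)

Section frac_int_parameter.
Context {R : realType}.
Local Notation mu := (@lebesgue_measure R).

(** By compactness |f| <= M, so the integrable kernel times M dominates; the integral is bounded and
    depends continuously on x in the open interval. *)
Lemma bounded_measurable_frac_int (L T u beta : R) (f : R -> R -> R) :
  0 < beta -> u <= T ->
  {within `[0, L] `*` `[0, T], continuous (uncurry f)} ->
  bounded_measurable L (fun x => frac_int beta (f x) u).
Proof.
move=> beta0 uT cf.
have [M M0 fM] : exists2 M : R, 0 < M &
    forall x s, 0 <= x <= L -> 0 <= s <= T -> `|f x s| <= M.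
  have /compact_bounded : compact (uncurry f @` (`[0, L] `*` `[0, T])).
    by apply: continuous_compact => //; apply: compact_setX; exact: segment_compact.
  move=> /ex_strict_bound_gt0[k k0 vk]; exists k => // x s xL sT.
  by apply/ltW/vk; exists (x, s) => //=; rewrite !in_itv.
have oc (a b c : R) : a < c < b -> a <= c <= b.
  by move=> /andP[/ltW -> /ltW ->].
(* Joint continuity relative to the closed rectangle becomes a product neighbourhood at interior
   points, which gives continuity in each variable. *)
have key x s W : 0 < x < L -> 0 < s < T -> nbhs (f x s) W ->
    exists N1 N2, [/\ nbhs x N1, nbhs s N2 & forall x' s', N1 x' -> N2 s' ->
      0 < x' < L -> 0 < s' < T -> W (f x' s')].
  move=> xL sT Wn.
  have Axs : (`[0, L] `*` `[0, T]) (x, s) by split; rewrite /= in_itv/= oc.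
  have [[N1 N2] [N1x N2s] sub] := (@subspace_continuousP _ _ _ _).1 cf (x, s) Axs W Wn.
  exists N1, N2; split => // x' s' N1x' N2s' x'L s'T.
  by apply: (sub (x', s')) => //; split; rewrite /= in_itv/= oc.
have sT s : 0 < s < u -> 0 < s < T.
  by move=> /andP[-> su]; exact: lt_le_trans uT.
have cfx s : 0 < s < u -> {in `]0, L[%classic, continuous (f ^~ s)}.
  move=> su x; rewrite inE/= in_itv/= => xL W Wn.
  have [N1 [N2 [N1x N2s sub]]] := key x s W xL (sT s su) Wn.
  have xin : x \in `]0, L[ by rewrite in_itv.
  have := near_in_itvoo xin.
  apply: filterS2 N1x => x' N1x'; rewrite in_itv/= => x'L.
  by apply: sub => //; [exact: nbhs_singleton|exact: sT].
have cfs x : 0 < x < L -> {in `]0, u[%classic, continuous (f x)}.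
  move=> xL s; rewrite inE/= in_itv/= => su W Wn.
  have [N1 [N2 [N1x N2s sub]]] := key x s W xL (sT s su) Wn.
  have sin : s \in `]0, u[ by rewrite in_itv.
  have := near_in_itvoo sin.
  apply: filterS2 N2s => s' N2s'; rewrite in_itv/= => s'u.
  by apply: sub => //; [exact: nbhs_singleton|exact: sT].
have ub x s : 0 < x < L -> 0 < s < u ->
    `|omega beta (u - s) * f x s| <= omega beta (u - s) * M.
  move=> xL su; rewrite normrM ger0_norm ?omega_ge0// ler_wpM2l ?omega_ge0//.
  by rewrite fM ?oc// sT.
have Iom : mu.-integrable `]0, u[ (EFin \o (fun s => omega beta (u - s) * M)).
  apply: (@eq_integrable _ _ _ mu `]0, u[ (measurable_itv _)
    (fun s => M%:E * (EFin \o (fun s => komega beta (u - s))) s)%E).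
    move=> s; rewrite inE/= in_itv/= => /andP[_ su].
    by rewrite /= -EFinM mulrC komegaE// subr_gt0.
  apply: integrableZl; first exact: measurable_itv.
  exact: integrable_komega_rev.
have int_f x : 0 < x < L ->
    mu.-integrable `]0, u[ (EFin \o (fun s => omega beta (u - s) * f x s)).
  move=> xL; apply: le_integrable Iom.
  - exact: measurable_itv.
  - apply/measurable_EFinP; apply: measurable_funM.
      apply: measurable_funTS; rewrite /omega; apply: measurable_funM => //.
      apply: (measurableT_comp (measurable_powR _)).
      exact: measurable_funB.
    by apply: open_continuous_measurable_fun; [exact: interval_open|exact: cfs].
  - move=> s; rewrite /= in_itv/= => su.
    rewrite lee_fin (le_trans (ub x s xL su))//; exact: ler_norm.
split.
  apply: open_continuous_measurable_fun; first exact: interval_open.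
  apply: (@continuity_under_integral R _ _ mu
    (fun x s => omega beta (u - s) * f x s) `]0, u[ (measurable_itv _) 0 L _ _
    (fun s => omega beta (u - s) * M) Iom).
  - by move=> x; rewrite /= in_itv/=; exact: int_f.
  - apply: aeW => s; rewrite /= in_itv/= => su x xL.
    by apply: cvgM; [exact: cvg_cst|exact: cfx].
  - move=> x; rewrite /= in_itv/= => xL; apply: aeW => s; rewrite /= in_itv/= => su.
    exact: ub.
exists (\int[mu]_(s in `]0, u[) (omega beta (u - s) * M)) => x.
rewrite /= in_itv/= => xL.
apply: le_trans (@le_normr_Rintegral _ _ _ mu _ _ (measurable_itv _) (int_f x xL)) _.
apply: le_Rintegral; [exact: measurable_itv|exact: (integrable_norm (int_f x xL))|exact: Iom|].
by move=> s; rewrite /= in_itv/= => su; exact: ub.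
Qed.

End frac_int_parameter.

Section energy.
Context {R : realType}.
Variables (alpha L : R) (T : nat -> R) (n : nat) (U : nat -> R -> R) (Q : R).
Hypotheses (alpha01 : 0 < alpha < 1) (T0 : T 0%N = 0)
  (Tincr : forall k, (k < n.+1)%N -> T k < T k.+1)
  (bU : forall k, (k <= n.+1)%N -> bounded_measurable L (U k)) (Q0 : 0 <= Q).

(* Abel summation: the kernel weights are nonnegative and nondecreasing, and
   [|(U k, U n)| <= |U k| |U n|] with equality for [k = n]. *)
Lemma dcaputo_l2norm_le :
  dcaputo alpha T (fun k => inner L (U k) (U n.+1)) n.+1 <= l2norm L (U n.+1) * Q ->
  dcaputo alpha T (fun k => l2norm L (U k)) n.+1 <= Q.
Proof.
move=> H; set W := l2norm L (U n.+1).
have a0 k : (k <= n)%N -> 0 <= acoef alpha T n.+1 k by move=> ?; exact: acoef_ge0.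
have aD k : (k < n)%N -> acoef alpha T n.+1 k <= acoef alpha T n.+1 k.+1.
  by move=> ?; exact: acoef_nondecreasing.
have W0 : 0 <= W := l2norm_ge0 L (U n.+1).
pose d k := W * l2norm L (U k) - inner L (U k) (U n.+1).
have d0 k : (k <= n.+1)%N -> 0 <= d k.
  move=> kn; rewrite subr_ge0 mulrC (le_trans (ler_norm _))//.
  by apply: inner_cauchy_schwarz; exact: bU.
have dn : d n.+1 = 0 by rewrite /d -expr2 sqr_l2norm subrr.
have := sum_nondecreasing_diff_le a0 aD (fun k kn => d0 k (leqW kn)).
rewrite dn mulr0.
have -> : \sum_(0 <= k < n.+1) acoef alpha T n.+1 k * (d k.+1 - d k) =
    W * dcaputo alpha T (fun k => l2norm L (U k)) n.+1 -
    dcaputo alpha T (fun k => inner L (U k) (U n.+1)) n.+1.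
  rewrite /dcaputo mulr_sumr -sumrB; apply: eq_bigr => k _.
  rewrite /d; move: (inner _ _ _) (inner _ _ _) (acoef _ _ _ _) => x y z; ring.
rewrite subr_le0 => /le_trans /(_ H).
(* Division by the last norm fails when it is 0; then Abel summation of the norms bounds the left
   side by 0 <= Q. *)
have := W0; rewrite le_eqVlt => /predU1P[W00 _|Wp]; last by rewrite ler_pM2l.
have := sum_nondecreasing_diff_le a0 aD (fun k _ => l2norm_ge0 L (U k)).
by rewrite -/W -W00 mulr0 => /le_trans; apply.
Qed.

End energy.

(** A [sup] dominates its set only if the set is bounded; here the maximum over the finite index
    range is a bound. *)
Lemma le_sup_image_itv (R : realType) (h : nat -> R) (P k : nat) :
  (1 <= k <= P)%N ->
  h k <= sup [set h k | k in [set k : nat | (1 <= k <= P)%N]].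
Proof.
move=> kP; apply: ub_le_sup; last by exists k.
exists (\big[Order.max/h 0]_(1 <= j < P.+1) h j) => _ [j /= jP <-].
by apply: le_bigmax_seq => //; rewrite mem_index_iota ltnS.
Qed.

Lemma bounded_measurable_Xh (R : realType) (L : R) s v : Xh L s v -> bounded_measurable L v.
Proof. by move=> [cv _ _ _]; exact: bounded_measurable_continuous. Qed.

Lemma int_subS1 (k : nat) : k.+1%:Z - 1 = k%:Z.
Proof. by lia. Qed.

Lemma int_subn2M (k N : nat) : (2 * N <= k)%N -> k%:Z - 2 * N%:Z = (k - 2 * N)%N%:Z.
Proof. by move=> ?; lia. Qed.

Theorem theorem4p1 (R : realType)
    (alpha tau p a b L r : R) (K N : nat)
    (halpha : 0 < alpha < 1) (htau : 0 < tau) (hK : (1 <= K)%N)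
    (hp : 0 < p) (ha : a <= 0) (hb : b != 0) (hL : 0 < L)
    (hN : (2 <= N)%N) (hr : 1 < r)
    (f : R -> R -> R)
    (hf : {within `[0, L] `*` `[0, K%:R * tau], continuous (uncurry f)})
    (t : int -> R) (ht : symmetric_graded_mesh tau r N K t)
    (q : R) (s : seq R) (hs : itv_partition 0 L s) (hq : quasi_uniform q L s)
    (phih u : int -> R -> R) :
  let G := fun (j : nat) (x : R) => frac_int (1 - alpha) (f x) (t j%:Z) in
  (forall n : nat, (1 <= n <= 2 * N)%N ->
     Xh L s (phih (n%:Z - 2 * N%:Z)) /\
     {in `[0, L], u (n%:Z - 2 * N%:Z) =1 phih (n%:Z - 2 * N%:Z)}) ->
  fem_scheme alpha p a b L N K t s G u ->
  let c := sup [set l2norm L (u (k%:Z - 2 * N%:Z)) |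
                k in [set k : nat | (1 <= k <= 2 * N)%N]] in
  let Lambda := (`|b| ^+ 2 + 1) * omega (2 - alpha) (K%:R * tau) in
  let sigma := Num.max (3 `^ (r - 1)) (2 `^ r - 1) in
  let z := fun j : nat =>
    2 * (c * `|b| * omega (2 - alpha) (t j%:Z) + l2norm L (G j)) in
  forall n : nat, (1 <= n <= 2 * K * N)%N ->
    l2norm L (u n%:Z) <=
      2 * mittag_leffler alpha (2 * Num.max 1 sigma * Lambda * t n%:Z `^ alpha)
      * (l2norm L (u 0)
         + omega (1 + alpha) (t n%:Z) * \big[Num.max/z 1%N]_(1 <= j < n.+1) z j).
Proof.
move=> G hphi hfem c Lambda sigma z n /[dup] n1K /andP[n1 nK].
have /andP[al0 al1] := halpha.
have oma0 : 0 < 1 - alpha by rewrite subr_gt0.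
have N1 : (0 < N)%N by exact: ltnW.
have P0 : (0 < 2 * N)%N by rewrite muln_gt0.
pose T (k : nat) : R := t k%:Z.
have T0 : T 0 = 0 by exact: mesh0 ht.
have Tincr k : (k < 2 * K * N)%N -> T k < T k.+1 by exact: mesh_incr ht k.
have Tle := ltS_ler Tincr.
have Tge0 k : (k <= 2 * K * N)%N -> 0 <= T k by move=> kn; rewrite -T0 Tle.
have TK k : (k <= 2 * K * N)%N -> T k <= K%:R * tau.
  have <- : T (2 * K * N) = K%:R * tau by exact: mesh_final ht.
  by move=> kK; rewrite Tle// kK leqnn.
have o2 : 1 <= 2 - alpha by lra.
have o20 : 0 < 2 - alpha by lra.
pose om := omega (2 - alpha).
(* This is [rho] times [L1coef], the weight in the delay integral; the step length has cancelled, so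
   the weights telescope. *)
pose Dl m k := om (T m - T k) - om (T m - T k.+1).
have Dl0 m k : (k < m <= 2 * K * N)%N -> 0 <= Dl m k.
  move=> /andP[km mK]; have kk := leq_trans km mK.
  have Tkm : T k.+1 <= T m by rewrite Tle// km.
  have Tk := Tincr k kk.
  rewrite subr_ge0 /om ler_omega ?nnegrE ?subr_ge0//; last first.
    by rewrite lerD2l lerN2 ltW.
  by rewrite (le_trans _ Tkm)// ltW.
have sumDl m i j : (i <= j)%N -> \sum_(i <= k < j) Dl m k = om (T m - T i) - om (T m - T j).
  move=> ij; rewrite -[RHS]opprB -(telescope_sumr (fun k => om (T m - T k)) ij) -sumrN.
  by apply: eq_bigr => k _; rewrite opprB.
have om0 x : 0 <= om x by rewrite omega_ge0.
have bphi k : (1 <= k <= 2 * N)%N -> bounded_measurable L (u (k%:Z - 2 * N%:Z)).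
  move=> kN; have [/bounded_measurable_Xh bp up] := hphi k kN.
  apply: bounded_measurable_eq bp => x; rewrite inE/= => xD.
  by rewrite up//; exact: subset_itv_oo_cc.
have bu k : (k <= 2 * K * N)%N -> bounded_measurable L (u k%:Z).
  (* [u 0] lies outside the range of the scheme; it is the last history value, of index 2N - 2N. *)
  case: k => [_|k kK]; last by have [/bounded_measurable_Xh] := hfem k.+1 kK.
  have := bphi (2 * N)%N; rewrite P0 leqnn => /(_ isT).
  by rewrite int_subn2M// subnn.
have bG j : (j <= 2 * K * N)%N -> bounded_measurable L (G j).
  by move=> jK; apply: bounded_measurable_frac_int hf => //; exact: TK.
have cP k : (1 <= k <= 2 * N)%N -> l2norm L (u (k%:Z - 2 * N%:Z)) <= c.
  exact: (@le_sup_image_itv _ (fun k => l2norm L (u (k%:Z - 2 * N%:Z)))).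
have c0 : 0 <= c by rewrite (le_trans (l2norm_ge0 _ _) (cP 1%N _)).
pose w k := l2norm L (u k%:Z).
(* Terms with k < 2N carry history values, at most [c] in norm; their weights telescope to at most
   [om (T m)], which gives the first source term. *)
pose Q m := \sum_(2 * N <= k < m) `|b| * Dl m k * w (k.+1 - 2 * N)%N +
  (c * `|b| * om (T m) + l2norm L (G m)).
have Q0 m : (m <= 2 * K * N)%N -> 0 <= Q m.
  move=> mK; apply: addr_ge0; last first.
    by apply: addr_ge0; [apply: mulr_ge0 => //; apply: mulr_ge0|exact: l2norm_ge0].
  rewrite big_nat_cond; apply: sumr_ge0 => k /andP[/andP[_ km] _].
  apply: mulr_ge0; last exact: l2norm_ge0.
  by apply: mulr_ge0 => //; rewrite Dl0// km.
pose wd k := l2norm L (u (k.+1%:Z - 2 * N%:Z)).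
have wdE k : (2 * N <= k)%N -> wd k = w (k.+1 - 2 * N)%N.
  by move=> Nk; rewrite /wd /w int_subn2M// leqW.
have wdc k : (k < 2 * N)%N -> wd k <= c by move=> kN; apply: cP.
have sumQ m : (m <= 2 * K * N)%N ->
    \sum_(0 <= k < m) `|b| * Dl m k * wd k + l2norm L (G m) <= Q m.
  move=> mK; rewrite /Q addrA lerD2r.
  have head i : (i <= m)%N -> (i <= 2 * N)%N ->
      \sum_(0 <= k < i) `|b| * Dl m k * wd k <= c * `|b| * om (T m).
    move=> im iN; apply: (@le_trans _ _ (\sum_(0 <= k < i) c * `|b| * Dl m k)).
      rewrite big_nat_cond [leRHS]big_nat_cond; apply: ler_sum => k.
      move=> /andP[/andP[_ ki] _]; rewrite -[c * _ * _]mulrA [leRHS]mulrC.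
      apply: ler_wpM2l; last exact/wdc/(leq_trans ki).
      by apply: mulr_ge0 => //; rewrite Dl0// (leq_trans ki).
    rewrite -mulr_sumr sumDl// T0 subr0; apply: ler_wpM2l; first exact: mulr_ge0.
    by rewrite gerBl.
  have [Nm|mN] := leqP (2 * N) m; last first.
    by rewrite [X in _ <= X + _]big_geq ?add0r ?head// ltnW.
  rewrite (big_cat_nat _ Nm)//= addrC lerD ?head//.
  rewrite big_nat_cond [leRHS]big_nat_cond; apply: ler_sum => k.
  by move=> /andP[/andP[Nk _] _]; rewrite wdE.
have key m : (0 < m <= 2 * K * N)%N -> dcaputo alpha T w m <= Q m.
  case: m => [//|m] /andP[_ mK].
  apply: (@dcaputo_l2norm_le _ alpha L T m (fun k => u k%:Z)) => //.
  - by move=> k km; apply: Tincr; exact: leq_trans mK.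
  - by move=> k km; apply: bu; exact: leq_trans mK.
  - exact: Q0.
  have [Xm /(_ _ Xm) eqm] := hfem m.+1 mK.
  have bm := bounded_measurable_Xh Xm.
  have b0 := bform_ge0 bm (ltW hp) ha.
  have E1 : inner L (fun x => L1deriv alpha t (fun k => u k x) m.+1) (u m.+1%:Z) =
      dcaputo alpha T (fun k => inner L (u k%:Z) (u m.+1%:Z)) m.+1.
    rewrite /dcaputo (@eq_inner _ _ _ (fun x => \sum_(0 <= k < m.+1)
      acoef alpha T m.+1 k * (u k.+1%:Z x + -1 * u k%:Z x)) _ (u m.+1%:Z))//.
      have bk k : (k < m.+1)%N ->
          bounded_measurable L (u k%:Z) /\ bounded_measurable L (u k.+1%:Z).
        by move=> km; split; apply: bu; rewrite (leq_trans _ mK)// ltnW.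
      rewrite (@inner_suml _ _ 0 m.+1 _ (fun k x => u k.+1%:Z x + -1 * u k%:Z x))//.
        rewrite big_nat_cond [RHS]big_nat_cond; apply: eq_bigr => k /andP[/andP[_ km] _].
        have [b1 b2] := bk k km.
        rewrite innerDl ?innerZl//; last exact: bounded_measurableZ.
        by rewrite mulN1r.
      move=> k /andP[_ km]; have [b1 b2] := bk k km.
      by apply: bounded_measurableD => //; exact: bounded_measurableZ.
    move=> x _; rewrite /L1deriv big_add1/=; apply: eq_bigr => k _.
    rewrite /L1coef /rho int_subS1.
    by rewrite mulN1r.
  have bud k : (k < m.+1)%N -> bounded_measurable L (u (k.+1%:Z - 2 * N%:Z)).
    move=> km; have [kN|Nk] := ltnP k (2 * N); first exact: bphi.
    rewrite int_subn2M ?leqW//; apply: bu.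
    by rewrite (leq_trans (leq_subr _ _))// (leq_trans _ mK).
  have E2 : inner L (fun x => b * delay_int alpha t N (fun k => u k x) m.+1) (u m.+1%:Z) =
      \sum_(0 <= k < m.+1) (b * Dl m.+1 k) * inner L (u (k.+1%:Z - 2 * N%:Z)) (u m.+1%:Z).
    rewrite -inner_suml//.
    apply: eq_inner => // x _; rewrite /delay_int big_add1 mulr_sumr/=.
    rewrite big_nat_cond [RHS]big_nat_cond; apply: eq_bigr => k /andP[/andP[_ km] _].
    have Tk : T k.+1 - T k != 0.
      by rewrite gt_eqF// subr_gt0 Tincr// (leq_trans km).
    rewrite /L1coef /rho int_subS1 -/(T k) -/(T k.+1) -/(T m.+1) -/om -/(Dl m.+1 k).
    by rewrite mulrA [(T k.+1 - T k) * _]mulrC divfK.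
  have E3 : inner L (fun x => b * delay_int alpha t N (fun k => u k x) m.+1) (u m.+1%:Z) <=
      w m.+1 * \sum_(0 <= k < m.+1) `|b| * Dl m.+1 k * wd k.
    rewrite E2 mulr_sumr big_nat_cond [leRHS]big_nat_cond.
    apply: ler_sum => k /andP[/andP[_ km] _].
    rewrite (le_trans (ler_norm _))// !normrM (ger0_norm (Dl0 _ _ _)) ?km//.
    rewrite [leRHS]mulrC -!mulrA ler_wpM2l// ler_wpM2l ?Dl0 ?km//.
    by apply: inner_cauchy_schwarz => //; exact: bud.
  have E4 : inner L (G m.+1) (u m.+1%:Z) <= w m.+1 * l2norm L (G m.+1).
    rewrite mulrC (le_trans (ler_norm _))//.
    by apply: inner_cauchy_schwarz => //; exact: bG.
  rewrite -E1.
  have := ler_wpM2l (l2norm_ge0 L (u m.+1%:Z)) (sumQ m.+1 mK).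
  rewrite mulrDr -/(w m.+1); apply: le_trans.
  (* The form B(u, u) on the left of the tested scheme is nonnegative and is dropped. *)
  apply: le_trans (lerD E3 E4); rewrite -eqm lerDl//.
have Lambda0 : 0 <= Lambda by rewrite mulr_ge0// addr_ge0// exprn_ge0.
pose Z := \big[Num.max/z 1%N]_(1 <= j < n.+1) z j.
have zh0 j : 0 <= c * `|b| * om (T j) + l2norm L (G j).
  apply: addr_ge0; last exact: l2norm_ge0.
  by apply: mulr_ge0; [exact: mulr_ge0|exact: om0].
have zj0 j : 0 <= z j by exact: mulr_ge0 (ler0n _ 2) (zh0 j).
have Zz j : (0 < j <= n)%N -> z j <= Z.
  by move=> jn; apply: le_bigmax_seq => //; rewrite mem_index_iota ltnS.
have Z0 : 0 <= Z by rewrite (le_trans (zj0 1%N))// Zz.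
have h : w n <= mittag_leffler alpha (2 * Num.max 1 sigma * Lambda * T n `^ alpha) *
    (w 0%N + Z * omega (1 + alpha) (T n)).
  apply: (@delay_gronwall R alpha T n (2 * N) tau halpha T0 _ (ltW htau) _ _ Lambda
    Lambda0 w (fun m k => `|b| * Dl m k) Z (l2norm_ge0 _ _) Z0 _ _ P0).
  - by move=> k kn; apply: Tincr; exact: leq_trans nK.
  - move=> k kn; apply: (mesh_step_le htau hr hN ht); exact: leq_trans nK.
  - move=> m /andP[Nm mn]; rewrite /T (mesh_delay htau hr hN ht)//.
    by rewrite Nm (leq_trans mn).
  - move=> m k /andP[_ km] mn; rewrite mulr_ge0// Dl0// km.
    exact: leq_trans nK.
  (* The weights telescope to at most omega_(2-alpha)(T m - T (2N)) <= omega_(2-alpha)(K tau), and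
     |b| <= |b|^2 + 1. *)
  - move=> m mn; rewrite -mulr_sumr.
    have mK := leq_trans mn nK.
    have KT : 0 <= K%:R * tau by rewrite mulr_ge0// ltW.
    have bb : `|b| <= `|b| ^+ 2 + 1 by move: `|b| (normr_ge0 b) => x x0; nra.
    have [Nm|mN] := leqP (2 * N) m; last by rewrite big_geq ?mulr0// ltnW.
    rewrite sumDl// subrr /Lambda; apply: ler_pM => //.
      by rewrite subr_ge0 /om ler_omega ?nnegrE ?subr_ge0 ?Tle ?Nm ?leqnn.
    apply: (@le_trans _ _ (om (T m - T (2 * N)))); first by rewrite gerBl.
    have TN0 : 0 <= T (2 * N) by rewrite Tge0// (leq_trans Nm).
    have TNm : T (2 * N) <= T m by rewrite Tle// Nm.
    rewrite /om ler_omega ?nnegrE ?subr_ge0//.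
    by rewrite (le_trans _ (TK m mK))// gerBl.
  - move=> m /andP[m0 mn]; apply: (le_trans (key m _)).
      by rewrite m0 (leq_trans mn).
    rewrite lerD2l.
    apply: (@le_trans _ _ (z m)); last by apply: Zz; rewrite m0.
    by apply: ler_peMl; [exact: zh0|rewrite ler1n].
  - by rewrite n1 leqnn.
  (* Since 2 max(1, sigma) >= 1, the argument Lambda t_n^alpha may be enlarged to the stated one. *)
  - rewrite ler_wpM2r ?powR_ge0// ler_peMl//.
    have : 1 <= Num.max 1 sigma by rewrite le_max lexx.
    by lra.
rewrite -/(w n) -/(w 0%N) -/Z (le_trans h)// [Z * _]mulrC.
rewrite -[2 * mittag_leffler _ _ * _]mulrA; apply: ler_peMl; last by rewrite ler1n.
apply: mulr_ge0.
  apply: mittag_leffler_ge0 => //; apply: mulr_ge0; last exact: powR_ge0.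
  apply: mulr_ge0 => //; apply: mulr_ge0 => //.
  by rewrite le_max ler01.
apply: addr_ge0; first exact: l2norm_ge0.
by apply: mulr_ge0 => //; apply: omega_ge0; exact: addr_gt0.
Qed.
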